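(* Let $d \ge 2$ and $t \ge 1$ be integers, let $a_1, a_2, \ldots, a_N$ be a spherical $t$-design in $\mathbb{S}^d$, and let $\nu_N=N^{-1} \sum_{n=1}^N \delta_{a_n}$. For any $1 \le p < \infty$, we have \[ W_p \left( \nu_N , \mathrm{Vol} \right) \le \frac{C}{t} \] with the constant $C=14d \max \{ d \log (100d), p \}$.
   Context: $\mathbb{S}^d=\{x \in \mathbb{R}^{d+1}: |x|=1\}$ with geodesic distance $\rho(x,y)=\arccos\langle x,y\rangle$ and normalized (probability) surface measure $\mathrm{Vol}$; $\delta_a$ is the Dirac measure at $a$. A finite point set $a_1,\ldots,a_N\in\mathbb{S}^d$ is a spherical $t$-design if $\frac1N\sum_{n=1}^N f(a_n)=\int_{\mathbb{S}^d}f\,\mathrm{d}\mathrm{Vol}$ for all polynomials $f(x_1,\ldots,x_{d+1})$ with real coefficients of degree at most $t$. For $1 \le p<\infty$, $W_p(\mu,\nu)=\inf_{\vartheta}\left(\int \rho(x,y)^p\,\mathrm{d}\vartheta(x,y)\right)^{1/p}$, the infimum being over all Borel probability measures $\vartheta$ on $\mathbb{S}^d\times \mathbb{S}^d$ with marginals $\mu$ and $\nu$. *)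

(* Defs.v *)
From HB Require Import structures.
From mathcomp Require Import all_boot all_order all_algebra.
From mathcomp.multinomials Require Import mpoly.
From mathcomp Require Import all_classical all_reals all_analysis.
From mathcomp Require Import measurable_realfun lra.
Import Order.TTheory GRing.Theory Num.Theory numFieldNormedType.Exports.

Set Implicit Arguments.
Unset Strict Implicit.
Unset Printing Implicit Defensive.

Local Open Scope classical_set_scope.
Local Open Scope ring_scope.

(* R^n is n.-tuple R, whose canonical sigma-algebra is the product (i.e. Borel)
   one. *)
Section Euclid.
Variables (R : realType) (n : nat).
Implicit Types x y : n.-tuple R.

Definition inner x y : R := \sum_(i < n) tnth x i * tnth y i.

Definition enorm x : R := Num.sqrt (inner x x).

Definition dilate (r : R) x : n.-tuple R := [tuple r * tnth x i | i < n].

Lemma tnth_dilate r x i : tnth (dilate r x) i = r * tnth x i.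
Proof. by rewrite tnth_mktuple. Qed.

Lemma dilateA r s x : dilate r (dilate s x) = dilate (r * s) x.
Proof. by apply: eq_from_tnth => i; rewrite !tnth_dilate mulrA. Qed.

Lemma dilate1 x : dilate 1 x = x.
Proof. by apply: eq_from_tnth => i; rewrite tnth_dilate mul1r. Qed.

Lemma inner_ge0 x : 0 <= inner x x.
Proof. by apply: sumr_ge0 => i _; rewrite -expr2 sqr_ge0. Qed.

Lemma enorm_ge0 x : 0 <= enorm x.
Proof. exact: sqrtr_ge0. Qed.

Lemma enorm_dilate r x : 0 <= r -> enorm (dilate r x) = r * enorm x.
Proof.
move=> r0; rewrite /enorm.
have -> : inner (dilate r x) (dilate r x) = r ^+ 2 * inner x x.
  rewrite /inner mulr_sumr; apply: eq_bigr => i _.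
  by rewrite tnth_dilate expr2 mulrACA.
by rewrite sqrtrM ?sqr_ge0// sqrtr_sqr ger0_norm.
Qed.

Lemma measurable_enorm : measurable_fun [set: n.-tuple R] enorm.
Proof.
rewrite (_ : enorm = (@powR R ^~ 2^-1) \o (fun x => inner x x)); last first.
  by apply/funext => x /=; rewrite powR12_sqrt// inner_ge0.
apply: measurableT_comp; first exact: measurable_powR.
apply: measurable_sum => i.
by apply: measurable_funM; exact: measurable_tnth.
Qed.

Lemma normr_tnth_le x i : `|tnth x i| <= enorm x.
Proof.
rewrite -sqrtr_sqr /enorm ler_sqrt ?inner_ge0//.
rewrite /inner (bigD1 i)//= -expr2 lerDl.
by apply: sumr_ge0 => j _; rewrite -expr2 sqr_ge0.
Qed.

End Euclid.

(* Lebesgue measure on R^n, as the n-fold product of the one-dimensional one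
   transported along R^m * R ~ R^m.+1. *)
Section LebesgueN.
Variable R : realType.
Local Open Scope ereal_scope.

Definition tcons m (z : m.-tuple R * R) : m.+1.-tuple R :=
  [tuple of z.2 :: z.1].

Lemma measurable_tcons m : measurable_fun [set: m.-tuple R * R] (@tcons m).
Proof.
by apply: measurable_cons; [exact: measurable_snd|exact: measurable_fst].
Qed.

Definition lebesgue_step m (mu : {measure set (m.-tuple R) -> \bar R}) :
    set (m.+1.-tuple R) -> \bar R :=
  pushforward (mu \x @lebesgue_measure R) (@tcons m).

Section step_measure.
Variables (m : nat) (mu : {measure set (m.-tuple R) -> \bar R}).

Let step0 : lebesgue_step mu set0 = 0.
Proof. by apply: measure0; exact: measurable_tcons. Qed.

Let step_ge0 A : 0 <= lebesgue_step mu A.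
Proof. by apply: measure_ge0; exact: measurable_tcons. Qed.

Let step_sigma_additive : semi_sigma_additive (lebesgue_step mu).
Proof. by apply: measure_semi_sigma_additive; exact: measurable_tcons. Qed.

HB.instance Definition _ := isMeasure.Build _ _ _ (lebesgue_step mu)
  step0 step_ge0 step_sigma_additive.

End step_measure.

Fixpoint lebesgue_n n : {measure set (n.-tuple R) -> \bar R} :=
  match n with
  | 0 => \d_([tuple] : 0.-tuple R)
  | m.+1 => lebesgue_step (lebesgue_n m)
  end.

Lemma measurable_box n (a b : R) :
  measurable [set x : n.-tuple R | forall i, tnth x i \in `[a, b]].
Proof.
rewrite (_ : mkset _ = \bigcap_(i in [set: 'I_n])
    ((@tnth n R ^~ i) @^-1` [set` `[a, b]])); last first.
  by apply/seteqP; split => x /= h => [i _|i]; exact: h.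
apply: fin_bigcap_measurable => [|i _]; first exact: finite_finset.
by rewrite -[X in measurable X]setTI; exact: measurable_tnth.
Qed.

Lemma lebesgue_n_box n (a b : R) : (a <= b)%R ->
  lebesgue_n n [set x | forall i, tnth x i \in `[a, b]] = ((b - a) ^+ n)%:E.
Proof.
move=> ab; elim: n => [|n IH] /=.
  by rewrite diracE mem_set//= => -[].
rewrite /lebesgue_step /pushforward.
rewrite (_ : _ @^-1` _ =
    [set x | forall i, tnth x i \in `[a, b]] `*` [set` `[a, b]]); last first.
  apply/seteqP; split => -[x y] /=.
    move=> h; split.
      by move=> i; have := h (lift ord0 i); rewrite /tcons tnthS.
    by have := h ord0; rewrite /tcons tnth0.
  case=> hx hy i; rewrite /tcons; case: (unliftP ord0 i) => [j|] ->.
    by rewrite tnthS.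
  by rewrite tnth0.
rewrite product_measure1E//; last exact: measurable_box.
rewrite IH /= lebesgue_measure_itv/= lte_fin exprSr EFinM.
by case: ltgtP ab => // -> _; rewrite subrr.
Qed.

End LebesgueN.

Arguments lebesgue_n : simpl never.

Definition sphere (R : realType) (d : nat) : Type :=
  {x : d.+1.-tuple R | enorm x == 1}.

Section Sphere.
Variables (R : realType) (d : nat).
Local Notation S := (sphere R d).

Definition north_tuple : d.+1.-tuple R := [tuple (i == ord0)%:R | i < d.+1].

Lemma enorm_north : enorm north_tuple == 1.
Proof.
rewrite /enorm /inner (bigD1 ord0)//= big1 => [|i /negbTE i0].
  by rewrite addr0 tnth_mktuple eqxx mulr1 sqrtr1.
by rewrite tnth_mktuple i0 mul0r.
Qed.

Definition north : S := exist _ north_tuple enorm_north.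

HB.instance Definition _ := SubChoice.copy S {x : d.+1.-tuple R | enorm x == 1}.
HB.instance Definition _ := isPointed.Build S north.

Definition scoord (x : S) : d.+1.-tuple R := sval x.

Let meas : set (set S) := g_sigma_algebra_preimage scoord.

Let meas0 : meas set0.
Proof. exact: (@measurable0 _ (g_sigma_algebra_preimageType scoord)). Qed.

Let measC A : meas A -> meas (~` A).
Proof. exact: (@measurableC _ (g_sigma_algebra_preimageType scoord)). Qed.

Let meas_bigcup (F : (set S)^nat) :
  (forall i, meas (F i)) -> meas (\bigcup_i F i).
Proof.
exact: (@bigcupT_measurable _ (g_sigma_algebra_preimageType scoord)).
Qed.

(* Borel sigma-algebra of the sphere: traces of the Borel sets of R^d.+1 *)
HB.instance Definition _ := @isMeasurable.Build (preimage_display scoord)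
  S meas meas0 measC meas_bigcup.

Lemma measurable_scoord : measurable_fun [set: S] scoord.
Proof. by move=> _ B mB; exists B. Qed.

Lemma scoord_inj : injective scoord.
Proof. exact: val_inj. Qed.

Lemma enorm_scoord x : enorm (scoord x) = 1.
Proof. by apply/eqP; case: x. Qed.

Definition geodist (x y : S) : R := acos (inner (scoord x) (scoord y)).

Definition solid_cone (A : set S) : set (d.+1.-tuple R) :=
  [set z | exists x r, [/\ A x, 0 < r <= 1 & z = dilate r (scoord x)]].

Let radial (z : d.+1.-tuple R) : S := insubd north (dilate (enorm z)^-1 z).

Let enorm_radial (z : d.+1.-tuple R) : enorm z != 0 -> enorm (dilate (enorm z)^-1 z) == 1.
Proof. by move=> z0; rewrite enorm_dilate ?invr_ge0 ?enorm_ge0// mulVf. Qed.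

Let scoord_radial z : scoord (radial z) =
  if enorm z == 0 then north_tuple else dilate (enorm z)^-1 z.
Proof.
rewrite /scoord /radial; case: eqP => [z0|/eqP z0].
  rewrite -[sval _]/(val _) val_insubd.
  by rewrite enorm_dilate ?z0 ?mulr0 ?invr0// eq_sym oner_eq0.
by rewrite -[sval _]/(val _) val_insubd enorm_radial.
Qed.

Let radial_dilate x r : 0 < r -> radial (dilate r (scoord x)) = x.
Proof.
move=> r0; apply: scoord_inj; rewrite scoord_radial.
rewrite enorm_dilate ?ltW// enorm_scoord mulr1 gt_eqF//.
by rewrite dilateA mulVf ?gt_eqF// dilate1.
Qed.

Let measurable_radial : measurable_fun [set: d.+1.-tuple R] radial.
Proof.
move=> _ _ [B mB <-]; rewrite !setTI -comp_preimage.
suff /(_ measurableT B mB) : measurable_fun setT (scoord \o radial).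
  by rewrite setTI.
rewrite (_ : scoord \o radial = fun z =>
  if enorm z == 0 then north_tuple else dilate (enorm z)^-1 z); last first.
  by apply/funext => z /=; rewrite scoord_radial.
apply: measurable_fun_ifT => //.
  by apply: measurable_fun_eqr => //; exact: measurable_enorm.
apply/measurable_fun_tnthP => i.
rewrite (_ : _ \o _ = fun z => (enorm z `^ (-1)) * tnth z i); last first.
  by apply/funext => z /=; rewrite tnth_dilate powR_inv1// enorm_ge0.
apply: measurable_funM; last exact: measurable_tnth.
apply: (@measurableT_comp _ _ _ _ _ _ (@powR R ^~ (-1))) => //.
exact: measurable_enorm.
Qed.

Let punctured_ball : set (d.+1.-tuple R) := [set z | enorm z \in `]0, 1]].

Let measurable_punctured_ball : measurable punctured_ball.
Proof.
rewrite (_ : punctured_ball = (@enorm R d.+1) @^-1` [set` `]0, 1]])//.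
by rewrite -[X in measurable X]setTI; exact: measurable_enorm.
Qed.

Let solid_coneE A : solid_cone A = punctured_ball `&` radial @^-1` A.
Proof.
apply/seteqP; split => z /=.
  case=> x [r [Ax /andP[r0 r1] ->]].
  rewrite /punctured_ball /= in_itv/= radial_dilate//.
  by rewrite (enorm_dilate _ (ltW r0)) enorm_scoord mulr1 r0.
case=> zP Az; move: (zP); rewrite /punctured_ball/= in_itv/= => /andP[z0 z1].
exists (radial z), (enorm z); split => //.
by rewrite scoord_radial gt_eqF// dilateA mulfV ?gt_eqF// dilate1.
Qed.

Lemma measurable_solid_cone A : measurable A -> measurable (solid_cone A).
Proof.
move=> mA; rewrite solid_coneE; apply: measurableI => //.
by rewrite -[X in measurable X]setTI; exact: measurable_radial.
Qed.

Local Open Scope ereal_scope.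

Local Notation mu := (@lebesgue_n R d.+1).

(* By polar coordinates, the surface measure of A is d.+1 times the Lebesgue
   measure of the solid cone over A; the factor d.+1 is immaterial after
   normalization. *)
Definition cone_measure (A : set S) : \bar R := mu (solid_cone A).

Let cone_measure0 : cone_measure set0 = 0.
Proof.
rewrite /cone_measure (_ : solid_cone _ = set0) ?measure0//.
by apply/seteqP; split => // z [x [r []]].
Qed.

Let cone_measure_ge0 A : 0 <= cone_measure A.
Proof. exact: measure_ge0. Qed.

Let cone_measure_sigma_additive : semi_sigma_additive cone_measure.
Proof.
move=> F mF tF mUF; rewrite /cone_measure.
rewrite (_ : solid_cone (\bigcup_n F n) = \bigcup_n solid_cone (F n)); last first.
  apply/seteqP; split => z /=.
    by case=> x [r [[n _ Fnx] r01 ->]]; exists n => //; exists x, r.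
  by case=> n _ [x [r [Fnx r01 ->]]]; exists x, r; split => //; exists n.
apply: measure_semi_sigma_additive.
- by move=> n; exact: measurable_solid_cone.
- apply/trivIsetP => i j _ _ ij; move/trivIsetP : tF => /(_ i j I I ij).
  move=> FF; rewrite !solid_coneE; apply/seteqP; split => // z [[_ ?] [_ ?]].
  by have : (F i `&` F j) (radial z) by []; rewrite FF.
- by apply: bigcup_measurable => n _; exact: measurable_solid_cone.
Qed.

HB.instance Definition _ := isMeasure.Build _ _ _ cone_measure
  cone_measure0 cone_measure_ge0 cone_measure_sigma_additive.

Lemma cone_measure_setT_lty : cone_measure setT < +oo.
Proof.
have le : solid_cone setT `<=` [set z | forall i, tnth z i \in `[(-1)%R, 1%R]].
  rewrite solid_coneE => z [/= +] _ i; rewrite /punctured_ball/= in_itv/= => /andP[_ z1].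
  by rewrite in_itv/= -ler_norml (le_trans (normr_tnth_le _ _)).
apply: (@le_lt_trans _ _ (mu [set z | forall i, tnth z i \in `[(-1)%R, 1%R]])).
  apply: (@le_measure _ _ _ mu); [rewrite inE|rewrite inE|exact: le].
    exact: measurable_solid_cone.
  exact: measurable_box.
by rewrite lebesgue_n_box ?ltry// lerN10.
Qed.

Lemma cone_measure_setT_gt0 : 0 < cone_measure setT.
Proof.
pose c : R := (d.+1%:R)^-1%R.
have c0 : (0 < c)%R by rewrite invr_gt0.
have c2 : (c / 2 <= c)%R by lra.
pose B : set (d.+1.-tuple R) := [set z | forall i, tnth z i \in `[(c / 2)%R, c]].
have BP : B `<=` solid_cone setT.
  rewrite solid_coneE => z Bz; split => //=; rewrite /punctured_ball/= in_itv/=; apply/andP; split.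
    apply: (@lt_le_trans _ _ (c / 2)%R); first by rewrite divr_gt0.
    apply: (le_trans _ (normr_tnth_le z ord0)).
    have := Bz ord0; rewrite in_itv/= => /andP[h _].
    by rewrite (le_trans h)// ler_norm.
  rewrite /enorm -[leRHS]sqrtr1 ler_sqrt ?ler01// /inner.
  apply: (@le_trans _ _ (\sum_(i < d.+1) c)%R).
    apply: ler_sum => i _; have := Bz i; rewrite in_itv/= => /andP[h1 h2].
    have h0 : (0 <= tnth z i)%R by rewrite (le_trans _ h1)// divr_ge0// ltW.
    rewrite -[leRHS]mulr1 ler_pM// (le_trans h2)// invf_le1//.
    by rewrite ler1n.
  by rewrite sumr_const card_ord -mulr_natr mulVf.
apply: (@lt_le_trans _ _ (mu B)).
  by rewrite lebesgue_n_box// lte_fin exprn_gt0//; lra.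
apply: (@le_measure _ _ _ mu); [rewrite inE|rewrite inE|exact: BP].
  exact: measurable_box.
exact: measurable_solid_cone.
Qed.

Definition Vol (A : set S) : \bar R :=
  (fine (cone_measure setT))^-1%:E * cone_measure A.

Let k_ge0 : (0 <= (fine (cone_measure setT))^-1)%R.
Proof. by rewrite invr_ge0 fine_ge0. Qed.

Let VolE : Vol = mscale (NngNum k_ge0) cone_measure.
Proof. by []. Qed.

Let Vol0 : Vol set0 = 0. Proof. by rewrite VolE measure0. Qed.

Let Vol_ge0 A : 0 <= Vol A. Proof. by rewrite VolE. Qed.

Let Vol_sigma_additive : semi_sigma_additive Vol.
Proof. rewrite VolE; exact: measure_semi_sigma_additive. Qed.

HB.instance Definition _ := isMeasure.Build _ _ _ Vol
  Vol0 Vol_ge0 Vol_sigma_additive.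

Let Vol_setT : Vol setT = 1.
Proof.
have fin : cone_measure setT \is a fin_num.
  by rewrite ge0_fin_numE// cone_measure_setT_lty.
rewrite /Vol -[X in _ * X]fineK// -EFinM mulVf// fine_eq0//.
by rewrite gt_eqF// cone_measure_setT_gt0.
Qed.

HB.instance Definition _ := Measure_isProbability.Build _ _ _ Vol Vol_setT.

End Sphere.

Section Empirical.
Variables (R : realType) (d N : nat) (a : 'I_N -> sphere R d).
Local Open Scope ereal_scope.

Definition empirical (A : set (sphere R d)) : \bar R :=
  (N%:R^-1)%:E * \sum_(n < N) \d_(a n) A.

End Empirical.

(* msize f is the total degree of f plus one (and 0 for f = 0); repetitions
   among the a n are allowed. *)
Definition spherical_design (R : realType) (d t N : nat)
    (a : 'I_N -> sphere R d) : Prop :=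
  forall f : {mpoly R[d.+1]}, (msize f <= t.+1)%N ->
    (N%:R^-1 * \sum_(n < N) f.@[tnth (scoord (a n))])%:E =
    (\int[@Vol R d]_x (f.@[tnth (scoord x)])%:E)%E.

Section Wasserstein.
Variables (R : realType) (d : nat).
Local Notation S := (sphere R d).
Local Open Scope ereal_scope.

(* The product sigma-algebra on S * S is the Borel one, S being second
   countable. *)
Definition coupling (mu nu : set S -> \bar R) : set (probability (S * S)%type R) :=
  [set theta : probability (S * S)%type R | forall A, measurable A ->
    theta (A `*` setT) = mu A /\ theta (setT `*` A) = nu A].

Definition wasserstein (p : R) (mu nu : set S -> \bar R) : \bar R :=
  ereal_inf [set (\int[theta]_z ((geodist z.1 z.2) `^ p)%:E) `^ p^-1
            | theta in coupling mu nu].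

End Wasserstein.

(* Main.v *)
Require Import Defs.
From HB Require Import structures.
From mathcomp Require Import all_boot all_order all_algebra.
From mathcomp.multinomials Require Import mpoly.
From mathcomp Require Import all_classical all_reals all_analysis.
From mathcomp Require Import measurable_realfun ring lra.
Import Order.TTheory GRing.Theory Num.Theory numFieldNormedType.Exports.
Local Open Scope classical_set_scope.
Local Open Scope ring_scope.

Set Implicit Arguments.
Unset Strict Implicit.
Unset Printing Implicit Defensive.

(* Let D be the Dirichlet kernel of degree n, a polynomial in u = cos theta with
   D(1) = m = 2n+1, and K = D^h with h even and n h <= t. As <., y> composed with
   K is a polynomial of degree at most t, the design property and the rotation
   invariance of Vol show that the average of K(<a_n, y>) over n is the constant
   kappa = int K(<x, .>) dVol(x). Hence moving the atom a_n to the density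
   K(<a_n, .>) / kappa is a coupling of nu_N and Vol, whose cost of order L is
   int rho^L K / kappa.
     Since rho |D| <= 5, one has rho^L D^h <= 5^L D^q with h = L + q, and it
   remains to compare int D^q with int D^h. For q > d the former is at most of
   order m^(q-d), by |D| <= min(m, 2/|x-y|) and a dyadic decomposition into caps;
   the latter is at least of order m^(h-d), by D >= (23/24) m on the cap of
   radius 1/m. Cap volumes are compared with volumes of boxes, which loses a
   factor (const d)^d; its L-th root is harmless as soon as L >= d log(100d).
   Finally L is at least max(d log(100d), p), and W_p <= W_L. *)

(** * Invariance of the Lebesgue measure under shears *)

Section LebesgueInvariance.
Variable R : realType.
Local Open Scope ereal_scope.

(** The pushforward under the translation has the right value on half-open intervals, and this
    determines Lebesgue measure. *)
Lemma lebesgue_measure_translate (a : R) (A : set (measurableTypeR R)) :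
  measurable A ->
  lebesgue_measure ((fun x => x + a)%R @^-1` A) = lebesgue_measure A.
Proof.
pose f (x : measurableTypeR R) : measurableTypeR R := (x + a)%R.
have mf : measurable_fun setT f.
  by apply: measurable_funD => //; exact: measurable_cst.
move=> mA; apply/esym.
rewrite -[RHS]/(pushforward (@lebesgue_measure R) f A).
apply: (@lebesgue_measure_unique R (pushforward (@lebesgue_measure R) f)) => //.
move=> _ [[u v] _ <-].
rewrite /= /pushforward.
rewrite (_ : f @^-1` `]u, v] = `]u - a, v - a]%classic)%R; last first.
  apply/seteqP; split => x /=; rewrite !in_itv/= /f => /andP[? ?];
    by apply/andP; split; lra.
rewrite !lebesgue_measure_itv/= !lte_fin ltrD2r; case: ifP => // _.
by rewrite -!EFinD; congr (_%:E); ring.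
Qed.

Lemma sigma_finite_lebesgue_n n : sigma_finite setT (lebesgue_n R n).
Proof.
exists (fun k => [set x | forall i, tnth x i \in (`[- k%:R, k%:R]%R)]).
  apply/seteqP; split => // x _.
  pose k := Num.truncn (enorm x); exists k.+1 => // i.
  rewrite in_itv/= -ler_norml (le_trans (normr_tnth_le x i))// ltW//.
  by rewrite /k truncnS_gt.
move=> k; split; first exact: measurable_box.
by rewrite lebesgue_n_box ?ltry// lerNl (le_trans (y := 0%R))// oppr_le0.
Qed.

(* [lebesgue_n] with the sigma-finite structure required by Tonelli's theorem. *)
Definition lebesgue_n_sf n : set (n.-tuple R) -> \bar R := lebesgue_n R n.

HB.instance Definition _ n := isMeasure.Build _ _ _ (@lebesgue_n_sf n)
  (measure0 (lebesgue_n R n)) (measure_ge0 (lebesgue_n R n))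
  (@measure_semi_sigma_additive _ _ _ (lebesgue_n R n)).

HB.instance Definition _ n := Measure_isSigmaFinite.Build _ _ _
  (@lebesgue_n_sf n) (@sigma_finite_lebesgue_n n).

Definition lebesgue_preserving n (g : n.-tuple R -> n.-tuple R) :=
  measurable_fun setT g /\
  forall A, measurable A -> lebesgue_n R n (g @^-1` A) = lebesgue_n R n A.

Lemma lebesgue_preserving_comp n (g h : n.-tuple R -> n.-tuple R) :
  lebesgue_preserving g -> lebesgue_preserving h -> lebesgue_preserving (g \o h).
Proof.
move=> [mg gA] [mh hA]; split; first exact: measurableT_comp.
move=> A mA; rewrite comp_preimage hA ?gA//.
by rewrite -[X in measurable X]setTI; exact: mg.
Qed.

Lemma lebesgue_nS n A : lebesgue_n R n.+1 A =
  (lebesgue_n R n \x @lebesgue_measure R) (@tcons R n @^-1` A).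
Proof. by []. Qed.

Lemma measurable_tcons_preimage n (A : set (n.+1.-tuple R)) : measurable A ->
  measurable (@tcons R n @^-1` A).
Proof.
by move=> mA; rewrite -[X in measurable X]setTI; exact: measurable_tcons.
Qed.

(** By Tonelli: over each fixed tail [z] the map is a translation of the head coordinate. *)
Lemma lebesgue_preserving_head n (g : n.+1.-tuple R -> n.+1.-tuple R)
    (f : n.-tuple R -> R) : measurable_fun setT g ->
  (forall z x, g (tcons (z, x)) = tcons (z, x + f z)%R) ->
  lebesgue_preserving g.
Proof.
move=> mg gE; split=> // A mA; rewrite !lebesgue_nS /product_measure1.
apply: eq_integral => z _ /=.
rewrite -[RHS](lebesgue_measure_translate (f z)); last first.
  by apply: measurable_xsection; exact: measurable_tcons_preimage.
by congr (lebesgue_measure _); apply/seteqP; split => x;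
  rewrite /xsection/= !inE/= gE.
Qed.

(** Tonelli in the other order: once the head [x] is frozen, the map acts on the tail by the
    volume-preserving [h x]. *)
Lemma lebesgue_preserving_tail n (g : n.+1.-tuple R -> n.+1.-tuple R)
    (h : R -> n.-tuple R -> n.-tuple R) : measurable_fun setT g ->
  (forall x, lebesgue_preserving (h x)) ->
  (forall z x, g (tcons (z, x)) = tcons (h x z, x)) ->
  lebesgue_preserving g.
Proof.
move=> mg hP gE; split=> // A mA; rewrite !lebesgue_nS.
(* [\x] integrates over the tail the measures of the head sections; sections at a fixed head require
   the reversed iterated integral. *)
have lebE B : measurable B ->
    (lebesgue_n R n \x @lebesgue_measure R) B =
    (@lebesgue_n_sf n \x^ @lebesgue_measure R) B.
  move=> mB.
  rewrite (@product_measure_unique _ _ _ _ _ (@lebesgue_n_sf n) _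
    (@lebesgue_n_sf n \x^ @lebesgue_measure R))//.
  by move=> B1 B2 mB1 mB2; exact: (@product_measure2E _ _ _ _ _ (@lebesgue_n_sf n)).
have mgA : measurable (g @^-1` A).
  by rewrite -[X in measurable X]setTI; exact: mg.
rewrite !lebE; [|exact: measurable_tcons_preimage..].
rewrite /product_measure2; apply: eq_integral => x _ /=.
rewrite -[RHS](hP x).2; last first.
  by apply: measurable_ysection; exact: measurable_tcons_preimage.
by congr (lebesgue_n R n _); apply/seteqP; split => z;
  rewrite /ysection/= !inE/= gE.
Qed.

Definition coord_add n (i : 'I_n) (a : R) (z : n.-tuple R) : n.-tuple R :=
  [tuple tnth z k + (if k == i then a else 0) | k < n]%R.

Definition shear n (i j : 'I_n) (s : R) (z : n.-tuple R) :=
  coord_add i (s * tnth z j) z.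

Lemma measurable_coord_add n (i : 'I_n) (f : n.-tuple R -> R) :
  measurable_fun setT f ->
  measurable_fun setT (fun z => coord_add i (f z) z).
Proof.
move=> mf; apply/measurable_fun_tnthP => k.
rewrite (_ : _ \o _ =
    fun z => tnth z k + (if k == i then f z else 0))%R; last first.
  by apply/funext => z; exact: tnth_mktuple.
apply: measurable_funD; first exact: measurable_tnth.
by case: (k == i) => //; exact: measurable_cst.
Qed.

Lemma coord_add_head n a (z : n.-tuple R) x :
  coord_add ord0 a (tcons (z, x)) = tcons (z, x + a)%R.
Proof.
apply: eq_from_tnth => k; rewrite tnth_mktuple /tcons.
by case: (unliftP ord0 k) => [j|] ->; rewrite ?tnthS ?tnth0//= addr0.
Qed.

Lemma coord_add_tail n i a (z : n.-tuple R) x :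
  coord_add (lift ord0 i) a (tcons (z, x)) = tcons (coord_add i a z, x)%R.
Proof.
apply: eq_from_tnth => k; rewrite tnth_mktuple /tcons.
case: (unliftP ord0 k) => [j|] ->; rewrite ?tnthS ?tnth0 ?tnth_mktuple.
  by rewrite (inj_eq (@lift_inj _ _)).
by rewrite addr0.
Qed.

Lemma lebesgue_preserving_coord_add n (i : 'I_n) a :
  lebesgue_preserving (coord_add i a).
Proof.
elim: n => [|n IH] in i *; first by case: i.
have mc : measurable_fun setT (coord_add i a).
  by apply: (measurable_coord_add i (f := fun=> a)).
case: (unliftP ord0 i) => [j|] ij; subst i.
  by apply: (lebesgue_preserving_tail (h := fun=> coord_add j a)) => // z x;
    rewrite coord_add_tail.
by apply: (lebesgue_preserving_head (f := fun=> a)) => // z x;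
  rewrite coord_add_head.
Qed.

(** Induction on the dimension: according to the places of [i] and [j], this is a shear of the tail,
    a translation of the tail depending on the head, or a translation of the head depending on the
    tail. *)
Lemma lebesgue_preserving_shear n (i j : 'I_n) s : i != j ->
  lebesgue_preserving (shear i j s).
Proof.
elim: n => [|n IH] in i j *; first by case: i.
move=> ij; have ms : measurable_fun setT (shear i j s).
  apply: measurable_coord_add; apply: measurable_funM.
    exact: measurable_cst.
  exact: measurable_tnth.
case: (unliftP ord0 i) => [i'|] ii; case: (unliftP ord0 j) => [j'|] jj;
  subst i j => //.
- apply: (lebesgue_preserving_tail (h := fun=> shear i' j' s)) => //.
    by move=> _; apply: IH; apply: contraNneq ij => ->.
  by move=> z x; rewrite /shear coord_add_tail /tcons tnthS.
- apply: (lebesgue_preserving_tail (h := fun x => coord_add i' (s * x)%R)) => //.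
    by move=> x; exact: lebesgue_preserving_coord_add.
  by move=> z x; rewrite /shear coord_add_tail /tcons tnth0.
- apply: (lebesgue_preserving_head (f := fun z => s * tnth z j')%R) => //.
  by move=> z x; rewrite /shear coord_add_head /tcons tnthS.
Qed.

End LebesgueInvariance.

(** * Rotation invariance of the surface measure *)

Section Rotations.
Variable R : realType.

Definition givens n (i j : 'I_n) (c s : R) (z : n.-tuple R) : n.-tuple R :=
  [tuple if k == i then c * tnth z i - s * tnth z j
         else if k == j then s * tnth z i + c * tnth z j
         else tnth z k | k < n].

(* A plane rotation is a product of three shears. *)
Lemma lebesgue_preserving_givens n (i j : 'I_n) c s :
  i != j -> c ^+ 2 + s ^+ 2 = 1 -> c != -1 ->
  lebesgue_preserving (givens i j c s).
Proof.
(* [t] is minus the tangent of half the angle; the two outer shears have coefficient [t] and the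
   middle one [s]. The half turn [c = -1] has no such tangent. *)
move=> ij cs cN1; pose t := - s / (1 + c).
have c1 : 1 + c != 0 by rewrite addrC -[1]opprK subr_eq0.
have ji : j != i by rewrite eq_sym.
rewrite (_ : givens i j c s = shear i j t \o (shear j i s \o shear i j t)).
  by do 2?apply: lebesgue_preserving_comp; exact: lebesgue_preserving_shear.
have ts : 1 + t * s = c.
  apply: (mulIf c1); rewrite mulrDl mul1r /t mulrAC mulfVK//.
  by move: cs; rewrite !expr2; lra.
have tc : t * (1 + c) = - s by rewrite /t mulfVK.
apply/funext => z; apply: eq_from_tnth => k.
rewrite /shear /coord_add/= !tnth_mktuple !eqxx (negbTE ji) !addr0.
set x := tnth z i; set y := tnth z j.
have [->|ki] := eqVneq k i.
  rewrite (negbTE ij) addr0.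
  have -> : c * x - s * y = (1 + t * s) * x + (t * (1 + (1 + t * s))) * y.
    by rewrite ts tc; ring.
  by rewrite -/x; ring.
have [->|kj] := eqVneq k j; last by rewrite !addr0.
by rewrite !addr0 -ts -/y; ring.
Qed.

(** The transpose of the rotation matrix is obtained by changing the sign of the sine. *)
Lemma inner_givens n (i j : 'I_n) c s (x y : n.-tuple R) : i != j ->
  inner (givens i j c s x) y = inner x (givens i j c (- s) y).
Proof.
move=> ij; have ji : j != i by rewrite eq_sym.
rewrite /inner (bigD1 i)//= (bigD1 j)//= [RHS](bigD1 i)//= [X in _ = _ + X](bigD1 j)//=.
rewrite !tnth_mktuple !eqxx (negbTE ji).
rewrite (eq_bigr (fun k => tnth x k * tnth y k)); last first.
  by move=> k /andP[/negbTE ki /negbTE kj]; rewrite tnth_mktuple ki kj.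
rewrite [X in _ = _ + (_ + X)](eq_bigr (fun k => tnth x k * tnth y k)); last first.
  by move=> k /andP[/negbTE ki /negbTE kj]; rewrite tnth_mktuple ki kj.
by ring.
Qed.

Lemma givensK n (i j : 'I_n) c s : i != j -> c ^+ 2 + s ^+ 2 = 1 ->
  cancel (givens i j c s) (givens i j c (- s)).
Proof.
move=> ij cs z; have ji : j != i by rewrite eq_sym.
apply: eq_from_tnth => k; rewrite !tnth_mktuple !eqxx (negbTE ji).
have [->|ki] := eqVneq k i; first by rewrite -[RHS]mul1r -cs; ring.
have [->|kj] := eqVneq k j; first by rewrite -[RHS]mul1r -cs; ring.
by [].
Qed.

Lemma givens_dilate n (i j : 'I_n) c s r (z : n.-tuple R) :
  givens i j c s (dilate r z) = dilate r (givens i j c s z).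
Proof.
apply: eq_from_tnth => k; rewrite !tnth_mktuple.
by do 2?case: ifP => _; ring.
Qed.

Section Sphere.
Variable d : nat.
Local Notation S := (sphere R d).

Lemma enorm_givens n (i j : 'I_n) c s (x : n.-tuple R) : i != j ->
  c ^+ 2 + s ^+ 2 = 1 -> enorm (givens i j c s x) = enorm x.
Proof. by move=> ij cs; rewrite /enorm inner_givens// givensK. Qed.

(** The sigma-algebra of the sphere is the one induced by [scoord]. *)
Lemma measurable_to_sphere d' (T : measurableType d') (g : T -> S) :
  measurable_fun setT (@scoord R d \o g) -> measurable_fun setT g.
Proof.
move=> mg _ _ [B mB <-]; rewrite !setTI -comp_preimage.
by rewrite -[X in measurable X]setTI; exact: mg.
Qed.

Lemma sphere_lift (z : d.+1.-tuple R) : enorm z = 1 -> {x : S | scoord x = z}.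
Proof. by move=> /eqP z1; exists (exist _ z z1). Qed.

(** The rotation commutes with dilations, so the preimage of a solid cone is the solid cone over the
    preimage; invariance of [Vol] thus reduces to that of Lebesgue measure. *)
Lemma sphere_rotation (i j : 'I_d.+1) c s :
  i != j -> c ^+ 2 + s ^+ 2 = 1 -> c != -1 ->
  exists g : S -> S, [/\ measurable_fun setT g,
    forall x, scoord (g x) = givens i j c s (scoord x) &
    forall A, measurable A -> Vol (g @^-1` A) = Vol A].
Proof.
move=> ij cs cN1.
have gx (x : S) : enorm (givens i j c s (scoord x)) = 1.
  by rewrite enorm_givens// enorm_scoord.
have gix (x : S) : enorm (givens i j c (- s) (scoord x)) = 1.
  by rewrite enorm_givens ?sqrrN// enorm_scoord.
pose g (x : S) : S := sval (sphere_lift (gx x)).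
have gE x : scoord (g x) = givens i j c s (scoord x) by rewrite /g; case: sphere_lift.
have [mG GA] := lebesgue_preserving_givens ij cs cN1.
have mg : measurable_fun setT g.
  apply: measurable_to_sphere.
  rewrite (_ : _ \o _ = givens i j c s \o @scoord R d); last exact/funext.
  by apply: measurableT_comp => //; exact: measurable_scoord.
exists g; split; [exact: mg|exact: gE|move=> A mA].
rewrite /Vol; congr (_ * _)%E.
rewrite /cone_measure -[RHS]GA; last exact: measurable_solid_cone.
congr (lebesgue_n R d.+1 _); apply/seteqP; split => z /=.
  case=> x [r [Agx r01 ->]]; exists (g x), r; split => //.
  by rewrite givens_dilate gE.
case=> y [r [Ay r01 zE]].
have [x xE] := sphere_lift (gix y).
have gxE : g x = y.
  apply: scoord_inj; rewrite gE xE -{1}(opprK s) givensK//.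
  by rewrite sqrrN.
exists x, r; split => //=; first by rewrite gxE.
by rewrite xE -givens_dilate -zE givensK.
Qed.

Lemma measurable_inner (y : S) :
  measurable_fun setT (fun x : S => inner (scoord x) (scoord y)).
Proof.
apply: measurable_sum => i; apply: measurable_funM; last exact: measurable_cst.
apply: (measurableT_comp (f := fun z : d.+1.-tuple R => tnth z i)).
  exact: measurable_tnth.
exact: measurable_scoord.
Qed.

(** The rotation is moved from [y] to [x] as its transpose, then absorbed by the invariance of
    [Vol]. *)
Lemma ge0_integral_zonal_rotation (F : R -> \bar R) (i j : 'I_d.+1) c s (y y' : S) :
  i != j -> c ^+ 2 + s ^+ 2 = 1 -> c != -1 ->
  measurable_fun setT F -> (forall r, (0 <= F r)%E) ->
  scoord y' = givens i j c s (scoord y) ->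
  (\int[@Vol R d]_x F (inner (scoord x) (scoord y')) =
   \int[@Vol R d]_x F (inner (scoord x) (scoord y)))%E.
Proof.
move=> ij cs cN1 mF F0 yE.
have [|g [mg gE gV]] := @sphere_rotation i j c (- s) ij _ cN1.
  by rewrite sqrrN.
pose f x := F (inner (scoord x) (scoord y)).
have mf : measurable_fun setT f.
  by apply: (measurableT_comp mF); exact: measurable_inner.
transitivity (\int[@Vol R d]_x (f \o g) x)%E.
  apply: eq_integral => x _.
  rewrite -[RHS]/(F (inner (scoord (g x)) (scoord y))).
  by rewrite gE yE (inner_givens _ _ _ _ ij) opprK.
have f0 : {in [set: S], forall x, (0 <= f x)%E} by move=> x _; exact: F0.
have := ge0_integral_pushforward mg (@Vol R d) measurableT mf f0.
rewrite preimage_setT => <-.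
by apply: eq_measure_integral => A mA _; exact: gV.
Qed.

(* Rotating in the planes (0, i) annihilates the coordinates of [y] one by one. *)
Lemma ge0_integral_zonal (F : R -> \bar R) (y : S) : (1 <= d)%N ->
  measurable_fun setT F -> (forall r, (0 <= F r)%E) ->
  (\int[@Vol R d]_x F (inner (scoord x) (scoord y)) =
   \int[@Vol R d]_x F (inner (scoord x) (scoord (north R d))))%E.
Proof.
move=> d1 mF F0.
(* The coordinates still to be annihilated; their number is the induction measure. *)
pose supp (x : S) := [set k : 'I_d.+1 | (k != ord0) && (tnth (scoord x) k != 0)]%SET.
have step (x : S) i : i \in supp x -> exists x' : S,
    [/\ (#|supp x'| < #|supp x|)%N, 0 < tnth (scoord x') ord0 &
    (\int[@Vol R d]_z F (inner (scoord z) (scoord x')) =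
     \int[@Vol R d]_z F (inner (scoord z) (scoord x)))%E].
  rewrite inE => /andP[i0 xi0].
  set u := tnth (scoord x) ord0; set v := tnth (scoord x) i.
  pose r := Num.sqrt (u ^+ 2 + v ^+ 2).
  have v2 : 0 < v ^+ 2 by rewrite exprn_even_gt0.
  have uv : 0 < u ^+ 2 + v ^+ 2 by rewrite ltr_wpDl ?sqr_ge0.
  have r0 : 0 < r by rewrite sqrtr_gt0.
  have rn0 : r != 0 by rewrite gt_eqF.
  have r2 : r ^+ 2 = u ^+ 2 + v ^+ 2 by rewrite sqr_sqrtr// ltW.
  (* This angle sends the pair (u, v) to (r, 0). The new coordinate 0 is positive, so the process
     cannot end at the south pole. *)
  have cs : (u / r) ^+ 2 + (- v / r) ^+ 2 = 1.
    by rewrite !expr_div_n sqrrN -mulrDl -r2 divff// expf_neq0.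
  have cN1 : u / r != -1.
    apply/eqP => ur; have : v ^+ 2 = 0; last by move=> v0; rewrite v0 ltxx in v2.
    have := cs; rewrite ur sqrrN expr1n -[in RHS](addr0 1) => /addrI/eqP.
    by rewrite sqrf_eq0 mulf_eq0 invr_eq0 (negbTE rn0) orbF oppr_eq0 => /eqP ->; rewrite expr0n.
  have i0' : ord0 != i by rewrite eq_sym.
  have [x' x'E] : {x' : S | scoord x' = givens ord0 i (u / r) (- v / r) (scoord x)}.
    by apply: sphere_lift; rewrite enorm_givens// enorm_scoord.
  have x'0 : tnth (scoord x') ord0 = r.
    rewrite x'E tnth_mktuple eqxx -/u -/v; apply: (mulIf rn0).
    by rewrite -expr2 r2; field.
  exists x'; split; last exact: ge0_integral_zonal_rotation x'E.
    apply: proper_card; apply/properP; split.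
      apply/fintype.subsetP => k; rewrite !inE => /andP[k0 x'k].
      apply/andP; split; first exact: k0.
      move: x'k; rewrite x'E tnth_mktuple; case: ifP => [k0'|_].
        by move: k0; rewrite k0'.
      by case: ifP => // /eqP ->.
    exists i; first by rewrite inE; apply/andP; split.
    rewrite inE negb_and !negbK; apply/orP; right.
    rewrite x'E tnth_mktuple; case: ifP => [i0''|_]; first by move: i0; rewrite i0''.
    by rewrite eqxx -/u -/v; apply/eqP; field.
  by rewrite x'0.
have main k (x : S) : (#|supp x| <= k)%N -> tnth (scoord x) ord0 != -1 ->
    (\int[@Vol R d]_z F (inner (scoord z) (scoord x)) =
     \int[@Vol R d]_z F (inner (scoord z) (scoord (north R d))))%E.
  elim: k x => [|k IH] x xk x0; last first.
    have [s0|[i ix]] := set_0Vmem (supp x); first by apply: IH; rewrite // s0 cards0.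
    have [x' [x'x x'0 <-]] := step _ _ ix; apply: IH.
      by rewrite -ltnS (leq_trans x'x).
    by rewrite gt_eqF// (lt_trans _ x'0)// oppr_lt0.
  have xE j : j != ord0 -> tnth (scoord x) j = 0.
    move=> j0; apply/eqP/negP => /negP xj.
    move: xk; rewrite leqn0 cards_eq0 => /eqP/setP/(_ j).
    by rewrite !inE j0 xj.
  suff -> : x = north R d by [].
  have : inner (scoord x) (scoord x) = 1.
    have := enorm_scoord x; rewrite /enorm => /(congr1 (fun r => r ^+ 2)).
    by rewrite sqr_sqrtr ?inner_ge0// expr1n.
  rewrite /inner (bigD1 ord0)//= big1 => [|j /xE ->]; last by rewrite mulr0.
  rewrite addr0 -expr2 => /eqP; rewrite sqrf_eq1 (negbTE x0) orbF => /eqP x1.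
  apply: scoord_inj; apply: eq_from_tnth => j.
  rewrite [RHS]tnth_mktuple; have [->|/xE//] := eqVneq j ord0.
  exact: x1.
(* At the south pole nothing is left to annihilate, but the pole is the wrong one: a quarter turn
   first makes coordinate [j] equal to -1, and then [step] applies. *)
have [y0|] := eqVneq (tnth (scoord y) ord0) (-1); last exact: (main #|supp y|).
have [j j0] : {j : 'I_d.+1 | ord0 != j} by exists (Ordinal (d1 : (1 < d.+1)%N)).
have cs : (0 : R) ^+ 2 + 1 ^+ 2 = 1 by rewrite expr0n expr1n add0r.
have cN1 : 0 != -1 :> R by rewrite eq_sym oppr_eq0 oner_eq0.
have [y' y'E] : {y' : S | scoord y' = givens ord0 j 0 1 (scoord y)}.
  by apply: sphere_lift; rewrite enorm_givens// enorm_scoord.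
rewrite -(ge0_integral_zonal_rotation j0 cs cN1 mF F0 y'E).
have y'j : tnth (scoord y') j = -1.
  rewrite y'E tnth_mktuple eq_sym (negbTE j0) eqxx y0; ring.
have : j \in supp y'.
  by rewrite inE eq_sym j0 y'j oppr_eq0 oner_eq0.
move=> /step[x' [_ x'0 <-]]; apply: (main #|supp x'|) => //.
by rewrite gt_eqF// (lt_trans _ x'0)// oppr_lt0.
Qed.

End Sphere.
End Rotations.

(** * The Dirichlet kernel *)

Section DirichletKernel.
Variable R : realType.

(** Chebyshev polynomials of the first kind. *)
Fixpoint cheb (n : nat) : {poly R} :=
  match n with
  | 0 => 1
  | (m.+1 as k) => if m is l.+1 then 'X * cheb m *+ 2 - cheb l else 'X
  end.

Definition dirichlet (n : nat) : {poly R} := 1 + \sum_(j < n) cheb j.+1 *+ 2.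

Lemma chebSS n : cheb n.+2 = 'X * cheb n.+1 *+ 2 - cheb n.
Proof. by []. Qed.

Lemma cheb_cos n (x : R) : (cheb n).[cos x] = cos (n%:R * x).
Proof.
suff : (cheb n).[cos x] = cos (n%:R * x) /\
    (cheb n.+1).[cos x] = cos (n.+1%:R * x) by case.
elim: n => [|n [IH1 IH2]]; first by rewrite /= !hornerE cos0.
split => //; rewrite chebSS hornerD hornerN hornerMn hornerM hornerX IH1 IH2.
have -> : n.+2%:R * x = n.+1%:R * x + x by rewrite -[n.+2%:R]natr1 mulrDl mul1r.
have -> : n%:R * x = n.+1%:R * x - x by rewrite -[n.+1%:R]natr1 mulrDl mul1r addrK.
by rewrite cosB cosD mulr2n; ring.
Qed.

Lemma size_cheb n : (size (cheb n) <= n.+1)%N.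
Proof.
suff : (size (cheb n) <= n.+1)%N /\ (size (cheb n.+1) <= n.+2)%N by case.
elim: n => [|n [IH1 IH2]]; first by rewrite /= size_poly1 size_polyX.
split => //; rewrite chebSS (leq_trans (size_polyD _ _))// geq_max size_polyN.
rewrite (leq_trans IH1 (leqW (leqnSn _))) andbT.
rewrite mulr2n (leq_trans (size_polyD _ _))// maxnn.
by rewrite (leq_trans (size_polyMleq _ _))// size_polyX ltnS.
Qed.

Lemma dirichletS n : dirichlet n.+1 = dirichlet n + cheb n.+1 *+ 2.
Proof. by rewrite /dirichlet big_ord_recr/= addrA. Qed.

Lemma dirichlet0 : dirichlet 0 = 1.
Proof. by rewrite /dirichlet big_ord0 addr0. Qed.

Lemma size_dirichlet n : (size (dirichlet n) <= n.+1)%N.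
Proof.
elim: n => [|n IH]; first by rewrite dirichlet0 size_poly1.
rewrite dirichletS (leq_trans (size_polyD _ _))// geq_max (leqW IH) andTb.
by rewrite mulr2n (leq_trans (size_polyD _ _))// maxnn size_cheb.
Qed.

(** The closed form of the kernel, multiplied out so that it also holds where the sine vanishes. It
    telescopes: 2 cos y sin x = sin (y + x) - sin (y - x). *)
Lemma dirichlet_sin n (x : R) :
  (dirichlet n).[cos (x *+ 2)] * sin x = sin (n.*2.+1%:R * x).
Proof.
elim: n => [|n IH]; first by rewrite dirichlet0 hornerE !mul1r.
rewrite dirichletS hornerD hornerMn mulrDl IH cheb_cos.
set y := n.+1%:R * (x *+ 2).
have yE : y = n.+1.*2%:R * x.
  by rewrite /y -muln2 natrM mulr2n -mulr_natr; ring.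
rewrite (_ : n.*2.+1%:R * x = y - x); last first.
  by rewrite yE doubleS -[n.*2.+2]addn1 natrD mulrDl mul1r addrK.
rewrite (_ : n.+1.*2.+1%:R * x = y + x); last first.
  by rewrite yE -[n.+1.*2.+1]addn1 natrD mulrDl mul1r.
by rewrite sinB sinD mulr2n; ring.
Qed.

Lemma norm_dirichlet_le n (x : R) : -1 <= x <= 1 ->
  `|(dirichlet n).[x]| <= n.*2.+1%:R.
Proof.
move=> x1; elim: n => [|n IH]; first by rewrite dirichlet0 hornerE normr1.
rewrite dirichletS hornerD (le_trans (ler_normD _ _))//.
rewrite doubleS -[n.*2.+3]addn2 natrD lerD// hornerMn normrMn.
rewrite -(acosK x1) cheb_cos -[leRHS]/(1 *+ 2) lerMn2r/=.
by rewrite ler_norml cos_geN1 cos_le1.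
Qed.

Lemma sin_natl_le n (x : R) : `|sin (n%:R * x)| <= n%:R * `|sin x|.
Proof.
elim: n => [|n IH]; first by rewrite !mul0r sin0 normr0.
rewrite -natr1 !mulrDl !mul1r sinD (le_trans (ler_normD _ _))// !normrM lerD//.
  by rewrite (le_trans _ IH)// ler_piMr// ler_norml cos_geN1 cos_le1.
by rewrite ler_piMl// ler_norml cos_geN1 cos_le1.
Qed.

(** With x = cos t: 1 - cos (n t) = 2 sin^2 (n t / 2) <= n^2 * 2 sin^2 (t / 2) = n^2 (1 - cos t). *)
Lemma cheb_ge n (x : R) : -1 <= x <= 1 ->
  1 - n%:R ^+ 2 * (1 - x) <= (cheb n).[x].
Proof.
move=> x1; rewrite -(acosK x1) cheb_cos; set t := acos x.
have half (y : R) : cos y = 1 - 2 * sin (y / 2) ^+ 2.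
  have {1}-> : y = (y / 2) *+ 2 by rewrite -mulr_natr mulfVK.
  by rewrite cos_mulr2n sin2cos2 mulr2n; ring.
rewrite (half t) (half (_ * t)).
have := sin_natl_le n (t / 2); rewrite mulrA => h.
have h2 : sin (n%:R * t / 2) ^+ 2 <= n%:R ^+ 2 * sin (t / 2) ^+ 2.
  rewrite -!(real_normK (num_real (sin _))) -exprMn.
  by apply: lerXn2r; rewrite // nnegrE mulr_ge0.
nra.
Qed.

(** Sums the bounds of [cheb_ge]: with m = 2n + 1, twice the sum of the j^2 for j <= n is m (m^2 -
    1) / 12, at most m^3 / 12. *)
Lemma dirichlet_ge n (x : R) : -1 <= x <= 1 ->
  n.*2.+1%:R * (1 - (1 - x) * n.*2.+1%:R ^+ 2 / 12) <= (dirichlet n).[x].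
Proof.
move=> x1; have x0 : 0 <= 1 - x by lra.
elim: n => [|n IH].
  by rewrite dirichlet0 -[leLHS]/(1 * (1 - (1 - x) * 1 ^+ 2 / 12)) -polyC1 hornerC; lra.
rewrite dirichletS hornerD hornerMn mulr2n.
have := cheb_ge n.+1 x1; move: IH; set D := _.[_]; set c := _.[_].
rewrite doubleS -[n.*2.+3]addn2 -[n.+1%:R]natr1 -muln2 -[(n * 2).+1]addn1 !natrD natrM.
have : 0 <= n%:R :> R by [].
set k := n%:R; rewrite !mulr1n; nra.
Qed.

(** A weak form of Jordan's inequality. If cos x >= 1/2, the mean value theorem gives slope at least
    1/2; otherwise sin^2 x > 3/4, while 2/5 x < 4/5 as pi / 2 < 2. *)
Lemma sin_ge_linear (x : R) : 0 <= x <= pi / 2 -> 2 / 5 * x <= sin x.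
Proof.
move=> /andP[x0 xpi]; have /andP[_ pi2] := @pihalf_02 R.
have [cx|cx] := leP (1 / 2) (cos x); last first.
  have s0 : 0 <= sin x by rewrite sin_ge0_pi// x0/=; lra.
  have c0 : 0 <= cos x by apply: cos_ge0_pihalf; rewrite xpi andbT; lra.
  have := cos2Dsin2 x; nra.
have [c] : exists2 c, c \in `[0, x]%R & sin x - sin 0 = cos c * (x - 0).
  apply: MVT_segment => //.
  by apply: continuous_subspaceT => y; exact: continuous_sin.
rewrite in_itv/= sin0 !subr0 => /andP[c0 cx'] ->.
have : cos x <= cos c.
  rewrite leNgt ltr_cos ?in_itv/= -?leNgt//; apply/andP; split; lra.
nra.
Qed.

(** With x = cos t, 1 - x = 2 sin^2 (t / 2), and the left side becomes 2 sin^2 ((2n + 1) t / 2). As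
    2 (1 - x) is a squared chord, this is the bound of the kernel by 2 over the chord. *)
Lemma dirichlet_tail n (x : R) : -1 <= x <= 1 ->
  (1 - x) * (dirichlet n).[x] ^+ 2 <= 2.
Proof.
move=> x1; rewrite -(acosK x1); set t := acos x.
have -> : t = (t / 2) *+ 2 by rewrite -mulr_natr mulfVK.
rewrite {1}cos_mulr2n.
have := dirichlet_sin n (t / 2); set D := _.[_]; set s := sin (t / 2) => Ds.
rewrite (_ : _ * _ = (D * s) ^+ 2 * 2); last first.
  by rewrite exprMn /s sin2cos2 mulr2n; ring.
rewrite Ds; have := sin_max (n.*2.+1%:R * (t / 2)).
by rewrite ler_norml => /andP[]; nra.
Qed.

(** With t = acos x, |D| sin (t / 2) <= 1 and sin (t / 2) >= t / 5. *)
Lemma acos_dirichlet n (x : R) : -1 <= x <= 1 ->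
  acos x * `|(dirichlet n).[x]| <= 5.
Proof.
move=> x1; rewrite -{2}(acosK x1); set t := acos x.
have t0 : 0 <= t by exact: acos_ge0.
have tpi : t <= pi by exact: acos_lepi.
have {2}-> : t = (t / 2) *+ 2 by rewrite -mulr_natr mulfVK.
have := dirichlet_sin n (t / 2); set D := _.[_].
move=> /(congr1 Num.norm); rewrite normrM => Ds.
have := sin_max (n.*2.+1%:R * (t / 2)); rewrite -Ds.
have : 2 / 5 * (t / 2) <= sin (t / 2) by apply: sin_ge_linear; apply/andP; split; lra.
have := ler_norm (sin (t / 2)); have := normr_ge0 D; nra.
Qed.

End DirichletKernel.

(** * Zonal polynomials in several variables *)

Section ZonalPolynomials.
Variables (R : realType) (n : nat).

Definition zonal_mpoly (y : n.-tuple R) (p : {poly R}) : {mpoly R[n]} :=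
  \sum_(i < size p) p`_i *: (\sum_(k < n) tnth y k *: 'X_k) ^+ i.

Lemma meval_zonal (y x : n.-tuple R) (p : {poly R}) :
  (zonal_mpoly y p).@[tnth x] = p.[inner x y].
Proof.
rewrite horner_coef /zonal_mpoly raddf_sum; apply: eq_bigr => i _.
rewrite /= mevalZ rmorphXn/= raddf_sum; congr (_ * _ ^+ _).
by apply: eq_bigr => k _; rewrite /= mevalZ mevalXU mulrC.
Qed.

Lemma msize_exp_le (q : {mpoly R[n]}) i : (msize q <= 2)%N -> (msize (q ^+ i) <= i.+1)%N.
Proof.
move=> q2; elim: i => [|i IH]; first by rewrite expr0 msize1.
have [->|q0] := eqVneq q 0; first by rewrite expr0n/= mmeasure0.
rewrite exprS msizeM ?expf_neq0//.
by have := leq_sub2r 1 (leq_add q2 IH); rewrite !subn1.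
Qed.

(** Both [msize] and [size] are the degree plus one: composing with a linear form does not raise the
    degree. This makes the design hypothesis applicable to kernels. *)
Lemma msize_zonal (y : n.-tuple R) (p : {poly R}) :
  (msize (zonal_mpoly y p) <= size p)%N.
Proof.
rewrite (leq_trans (mmeasure_sum _ _ _ _))//; apply/bigmax_leqP => i _.
rewrite (leq_trans (msizeZ_le _ _))// (leq_trans _ (ltn_ord i))//.
apply: msize_exp_le; rewrite (leq_trans (mmeasure_sum _ _ _ _))//.
by apply/bigmax_leqP => k _; rewrite (leq_trans (msizeZ_le _ _))// msizeX mdeg1.
Qed.

End ZonalPolynomials.

(** * Volumes of spherical caps *)

Section CapVolume.
Variables (R : realType) (d : nat).
Local Notation S := (sphere R d).

(** Coordinate 0, the axis of the caps, gets a range of its own. *)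
Definition cylinder n (a b e : R) : set (n.+1.-tuple R) :=
  [set z | tnth z ord0 \in `[a, b] /\
           forall i : 'I_n, tnth z (lift ord0 i) \in `[- e, e]].

Lemma tcons_cylinder n (a b e : R) : @tcons R n @^-1` cylinder a b e =
  [set x | forall i, tnth x i \in `[- e, e]] `*` [set` `[a, b]].
Proof.
apply/seteqP; split => -[x y] /=; rewrite /cylinder/tcons/= tnth0.
  by move=> [yab h]; split => // i; have := h i; rewrite tnthS.
by move=> [h yab]; split => // i; rewrite tnthS.
Qed.

Lemma lebesgue_cylinder n (a b e : R) : a <= b -> 0 <= e ->
  lebesgue_n R n.+1 (cylinder a b e) = ((b - a) * (e *+ 2) ^+ n)%:E.
Proof.
move=> ab e0; rewrite lebesgue_nS tcons_cylinder product_measure1E//; last first.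
  exact: measurable_box.
rewrite lebesgue_n_box; last by rewrite (le_trans _ e0)// oppr_le0.
rewrite opprK -mulr2n /= lebesgue_measure_itv/= lte_fin mulrC EFinM.
by congr (_ * _)%E; case: ltgtP ab => // -> _; rewrite subrr.
Qed.

Lemma measurable_cylinder n (a b e : R) : measurable (@cylinder n a b e).
Proof.
rewrite (_ : cylinder a b e = (fun z => tnth z ord0) @^-1` [set` `[a, b]] `&`
  \bigcap_(i in [set: 'I_n]) ((fun z => tnth z (lift ord0 i)) @^-1` [set` `[- e, e]])).
  apply: (@measurableI _ (n.+1.-tuple R)).
    by rewrite -[X in measurable X]setTI; exact: measurable_tnth.
  apply: fin_bigcap_measurable => [|i _]; first exact: finite_finset.
  by rewrite -[X in measurable X]setTI; exact: measurable_tnth.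
apply/seteqP; split => z /=; first by move=> [h1 h2]; split => // i _; exact: h2.
by move=> [h1 h2]; split => // i; exact: h2.
Qed.

(** The cap around the north pole of chordal radius [s]: the left side is the squared distance from
    [x] to the pole. *)
Definition cap (s : R) : set S :=
  [set x | 2 * (1 - tnth (scoord x) ord0) <= s ^+ 2].

Lemma measurable_cap s : measurable (cap s).
Proof.
rewrite (_ : cap s = (fun x => tnth (scoord x) ord0) @^-1` `[1 - s ^+ 2 / 2, +oo[%classic).
  rewrite -[X in measurable X]setTI.
  have : measurable_fun setT (fun x : S => tnth (scoord x) ord0); last by apply.
  apply: (measurableT_comp (f := fun z : d.+1.-tuple R => tnth z ord0)).
    exact: measurable_tnth.
  exact: measurable_scoord.
by apply/seteqP; split => x; rewrite /cap/= in_itv/= andbT; lra.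
Qed.

Lemma sum_sqr_scoord (x : S) :
  tnth (scoord x) ord0 ^+ 2 + \sum_(i < d) tnth (scoord x) (lift ord0 i) ^+ 2 = 1.
Proof.
have := enorm_scoord x; rewrite /enorm => /(congr1 (fun r => r ^+ 2)).
rewrite sqr_sqrtr ?inner_ge0// expr1n => <-.
by rewrite /inner big_ord_recl -expr2; congr (_ + _).
Qed.

Lemma inner_north (x : S) : inner (scoord x) (scoord (north R d)) = tnth (scoord x) ord0.
Proof.
rewrite /inner (bigD1 ord0)//= big1 => [|i /negbTE i0].
  by rewrite tnth_mktuple eqxx mulr1 addr0.
by rewrite tnth_mktuple i0 mulr0.
Qed.

Lemma coord0_bounds (x : S) : -1 <= tnth (scoord x) ord0 <= 1.
Proof.
have := sum_sqr_scoord x.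
have : 0 <= \sum_(i < d) tnth (scoord x) (lift ord0 i) ^+ 2.
  by apply: sumr_ge0 => i _; rewrite sqr_ge0.
by move=> ? ?; apply/andP; split; nra.
Qed.

(** The cone lies in the box [-1, 1] x [-s, s]^d, because the squares of the other coordinates of
    [x] sum to 1 - x_0^2 <= 2 (1 - x_0) <= s^2. *)
Lemma cone_cap_le s : 0 <= s -> (cone_measure (cap s) <= (2 * (s *+ 2) ^+ d)%:E)%E.
Proof.
move=> s0; rewrite (_ : 2 = 1 - (-1) :> R); last by ring.
rewrite -lebesgue_cylinder//.
rewrite /cone_measure.
apply: (@le_measure _ _ _ (lebesgue_n R d.+1)); rewrite ?inE.
- by apply: measurable_solid_cone; exact: measurable_cap.
- exact: measurable_cylinder.
move=> _ [x [r [xs /andP[r0 r1] ->]]]; have x01 := coord0_bounds x.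
split; first by rewrite in_itv/= tnth_dilate; apply/andP; split; nra.
move=> i; rewrite in_itv/= tnth_dilate -ler_norml normrM.
apply: (@le_trans _ _ `|tnth (scoord x) (lift ord0 i)|).
  by rewrite ler_piMl// gtr0_norm.
rewrite -(ger0_norm s0) -ler_sqr ?nnegrE// !real_normK ?num_real//.
have := sum_sqr_scoord x; rewrite (bigD1 i)//= => xE.
have h : 0 <= \sum_(j < d | j != i) tnth (scoord x) (lift ord0 j) ^+ 2.
  by apply: sumr_ge0 => j _; rewrite sqr_ge0.
move: xs xE h; rewrite /cap/=.
set u := tnth _ ord0; set v := tnth _ (lift _ _); set w := \sum_(_ < _ | _) _.
by nra.
Qed.

(** The cone contains the box [1/2, 3/4] x [-e, e]^d: for z in it, with w the squared norm of its
    tail, 1/2 <= |z| <= 1 and |z| - z_0 <= w <= s^2 / 4. *)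
Lemma cone_cap_ge s : (1 <= d)%N -> 0 < s -> s <= 1 ->
  ((1 / 4 * (s / d%:R) ^+ d)%:E <= cone_measure (cap s))%E.
Proof.
move=> d1 s0 s1; have d0 : 0 < d%:R :> R by rewrite ltr0n.
have d1R : 1 <= d%:R :> R by rewrite ler1n.
(* Makes w at most d e^2 <= s^2 / 4 without any square root of d. *)
pose e := s / (2 * d%:R); have e0 : 0 <= e by rewrite divr_ge0 ?mulr_ge0 ?ltW.
have de : d%:R * e ^+ 2 <= s ^+ 2 / 4.
  have -> : d%:R * e ^+ 2 = s ^+ 2 / 4 / d%:R.
    by rewrite /e; field; rewrite gt_eqF.
  by rewrite ler_pdivrMr// ler_peMr// divr_ge0// sqr_ge0.
rewrite (_ : 1 / 4 = 3 / 4 - 1 / 2); last by field.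
rewrite (_ : s / d%:R = e *+ 2); last by rewrite /e -mulr_natr; field; rewrite gt_eqF.
rewrite -lebesgue_cylinder//; last by lra.
rewrite /cone_measure.
apply: (@le_measure _ _ _ (lebesgue_n R d.+1)); rewrite ?inE.
- exact: measurable_cylinder.
- by apply: measurable_solid_cone; exact: measurable_cap.
move=> z [z0 zi]; move: z0; rewrite in_itv/= => /andP[z0 z0'].
pose w := \sum_(i < d) tnth z (lift ord0 i) ^+ 2.
have w0 : 0 <= w by apply: sumr_ge0 => i _; rewrite sqr_ge0.
have we : w <= s ^+ 2 / 4.
  rewrite (le_trans _ de)// mulr_natl -[X in _ *+ X]card_ord -sumr_const.
  apply: ler_sum => i _; have := zi i; rewrite in_itv/= => /andP[]; nra.
pose r := enorm z.
have r2 : r ^+ 2 = tnth z ord0 ^+ 2 + w.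
  by rewrite sqr_sqrtr ?inner_ge0// /inner big_ord_recl -expr2; congr (_ + _).
have r0 : 0 <= r by exact: enorm_ge0.
have rz : tnth z ord0 <= r by nra.
have r1 : r <= 1 by nra.
have rn0 : r != 0 by rewrite gt_eqF//; lra.
have [x xE] : {x : S | scoord x = dilate r^-1 z}.
  by apply: sphere_lift; rewrite enorm_dilate ?invr_ge0// mulVf.
exists x, r; split.
- rewrite /cap/= xE tnth_dilate.
  have -> : 2 * (1 - r^-1 * tnth z ord0) = 2 * (r - tnth z ord0) / r by field.
  rewrite ler_pdivrMr; last by lra.
  have : r - tnth z ord0 <= s ^+ 2 / 4 by nra.
  by nra.
- by rewrite r1 andbT; lra.
- by rewrite xE dilateA mulfV// dilate1.
Qed.

End CapVolume.

(** * Integrals of powers of the Dirichlet kernel *)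

Section KernelIntegrals.
Variables (R : realType).

Lemma exprn_le k (a b : R) : 0 <= a -> a <= b -> a ^+ k <= b ^+ k.
Proof. by move=> a0 ab; apply: lerXn2r; rewrite // nnegrE// (le_trans a0). Qed.

Lemma measurable_horner (p : {poly R}) : measurable_fun setT (fun x : R => p.[x]).
Proof.
rewrite (_ : (fun x => p.[x]) = fun x => \sum_(i < size p) p`_i * x ^+ i).
  apply: measurable_sum => i; apply: measurable_funM; first exact: measurable_cst.
  exact: measurable_funX.
by apply/funext => x; rewrite horner_coef.
Qed.

Lemma integral_cst_indic dd (T : measurableType dd) (mu : {measure set T -> \bar R})
    (c : R) (A : set T) : 0 <= c -> measurable A ->
  (\int[mu]_x (c * \1_A x)%:E = c%:E * mu A)%E.
Proof.
move=> c0 mA; under eq_integral do rewrite EFinM.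
rewrite ge0_integralZl_EFin//; first by rewrite integral_indic// setIT.
by apply/measurable_EFinP; exact: measurable_indic.
Qed.

Variables (d n : nat).
Local Notation S := (sphere R d).
Local Notation m := (n.*2.+1%:R : R).
Local Notation D := (dirichlet R n).
Local Notation x0 x := (tnth (scoord x) ord0).

(** Kept symbolic: it occurs in the upper and the lower bounds alike and cancels, so the area of the
    sphere is never computed. *)
Definition vol_scale : R := (fine (@cone_measure R d setT))^-1.

Lemma vol_scale_gt0 : 0 < vol_scale.
Proof.
rewrite invr_gt0 fine_gt0// cone_measure_setT_gt0 cone_measure_setT_lty//.
Qed.

Lemma vol_scale_ge0 : 0 <= vol_scale. Proof. exact: ltW vol_scale_gt0. Qed.

Lemma VolE (A : set S) : Vol A = (vol_scale%:E * cone_measure A)%E.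
Proof. by []. Qed.

Lemma Vol_cap_le s : 0 <= s ->
  (Vol (@cap R d s) <= (vol_scale * (2 * (s *+ 2) ^+ d))%:E)%E.
Proof.
move=> s0; rewrite VolE EFinM; apply: lee_wpmul2l; last exact: cone_cap_le.
by rewrite lee_fin vol_scale_ge0.
Qed.

Lemma Vol_cap_ge s : (1 <= d)%N -> 0 < s -> s <= 1 ->
  ((vol_scale * (1 / 4 * (s / d%:R) ^+ d))%:E <= Vol (@cap R d s))%E.
Proof.
move=> d1 s0 s1; rewrite VolE EFinM; apply: lee_wpmul2l; last exact: cone_cap_ge.
by rewrite lee_fin vol_scale_ge0.
Qed.

Lemma measurable_coord0 : measurable_fun setT (fun x : S => x0 x).
Proof.
apply: (measurableT_comp (f := fun z : d.+1.-tuple R => tnth z ord0)).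
  exact: measurable_tnth.
exact: measurable_scoord.
Qed.

Lemma measurable_dirichlet0 q :
  measurable_fun setT (fun x : S => (D.[x0 x] ^+ q)%:E).
Proof.
apply/measurable_EFinP; apply: measurable_funX.
apply: (measurableT_comp (measurable_horner D)).
exact: measurable_coord0.
Qed.

(* Dyadic decomposition according to the size of [1 - u]. *)
Lemma dirichlet_dyadic q (u : R) : ~~ odd q -> -1 <= u <= 1 ->
  exists2 j : nat, (j <= n.*2.+1)%N /\ 2 * (1 - u) <= (2 ^+ j.+1 * 2 / m) ^+ 2 &
  D.[u] ^+ q <= m ^+ q / 2 ^+ (j * q).
Proof.
move=> qe u1; have m0 : 0 < m by [].
have u0 : 0 <= 1 - u by lra.
(* The chord is at most 2^(j+1) * 2 / m. For j = 2n + 1 this radius is at least the diameter 2, so a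
   least such [j] exists. *)
pose P j := 2 * (1 - u) <= (2 ^+ j.+1 * 2 / m) ^+ 2.
have PJ : P n.*2.+1.
  have mJ : m <= 2 ^+ n.*2.+2.
    by rewrite -natrX ler_nat (leq_trans (leqnSn _))// ltnW// ltn_expl.
  rewrite /P (@le_trans _ _ (2 ^+ 2))//; first by lra.
  apply: exprn_le => //.
  by rewrite ler_pdivlMr// mulrC ler_wpM2r.
have exP : exists j, P j by exists n.*2.+1.
case: (ex_minnP exP) => j Pj jmin; exists j; first by split; [exact: jmin|].
(* As [q] is even, |D| is to be bounded by m / 2^j. For j = 0 this is the trivial bound; for j > 0
   minimality puts [u] outside the previous cap, where [dirichlet_tail] applies. *)
rewrite exprM -expr_div_n -[_ ^+ q](ger0_norm (exprn_even_ge0 _ qe)) normrX.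
apply: exprn_le => //.
case: j Pj jmin => [|j] Pj jmin.
  by rewrite expr0 divr1; exact: norm_dirichlet_le.
have nPj : ~~ P j by apply/negP => /jmin; rewrite ltnn.
move: nPj; rewrite -ltNge => uj.
have := dirichlet_tail n u1; set E := D.[u] => tail.
pose a := 2 ^+ j.+1 * 2 / m; rewrite -/a in uj.
have a0 : 0 < a by rewrite /a divr_gt0 ?mulr_gt0 ?exprn_gt0.
have -> : m / 2 ^+ j.+1 = 2 / a.
  rewrite /a; field; rewrite ?gt_eqF ?exprn_gt0//.
rewrite ler_pdivlMr//.
rewrite leNgt; apply/negP => Ea.
have : 4 < (`|E| * a) ^+ 2 by nra.
rewrite exprMn real_normK ?num_real//; have := sqr_ge0 E; nra.
Qed.

Lemma sum_half_le k : \sum_(j < k) (2 : R)^-1 ^+ j <= 2.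
Proof.
suff -> : \sum_(j < k) (2 : R)^-1 ^+ j = 2 - 2 * 2^-1 ^+ k.
  by rewrite gerBl mulr_ge0// exprn_ge0.
elim: k => [|k IH]; first by rewrite big_ord0 expr0; ring.
by rewrite big_ord_recr/= IH exprS; field.
Qed.

(** The j-th cap contributes at most m^q / 2^(jq) times the cap bound 2 (2^j * 8 / m)^d. Since d <
    q, the terms are dominated by a geometric series of ratio 1/2, whose sum is at most 2. *)
Lemma integral_dirichlet_le q : ~~ odd q -> (d < q)%N ->
  (\int[@Vol R d]_x (D.[x0 x] ^+ q)%:E <=
   (vol_scale * (4 * 8 ^+ d * (m ^+ q / m ^+ d)))%:E)%E.
Proof.
move=> qe dq; have m0 : 0 < m by [].
have m1 : m != 0 by [].
pose r (j : nat) : R := 2 ^+ j.+1 * 2 / m.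
have r0 j : 0 <= r j by rewrite divr_ge0 ?mulr_ge0 ?exprn_ge0.
pose c (j : nat) : R := m ^+ q / 2 ^+ (j * q).
have c0 j : 0 <= c j by rewrite divr_ge0 ?exprn_ge0.
have c_ind_ge0 j (x : S) : (0 <= (c j * \1_(@cap R d (r j)) x)%:E)%E.
  by rewrite lee_fin mulr_ge0.
have mc j : measurable_fun setT (fun x : S => (c j * \1_(@cap R d (r j)) x)%:E).
  apply/measurable_EFinP; apply: measurable_funM; first exact: measurable_cst.
  by apply: measurable_indic; exact: measurable_cap.
apply: (@le_trans _ _ (\int[@Vol R d]_x
    (\sum_(j < n.*2.+2) (c j * \1_(@cap R d (r j)) x)%:E))%E).
  apply: ge0_le_integral => //.
  - by move=> x _; rewrite lee_fin exprn_even_ge0.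
  - exact: measurable_dirichlet0.
  - by apply: emeasurable_sum => j; exact: mc.
  move=> x _; have [j [jJ xj] Dx] := dirichlet_dyadic qe (coord0_bounds x).
  rewrite sumEFin lee_fin (le_trans Dx)//.
  have jJ' : (j < n.*2.+2)%N by [].
  rewrite (bigD1 (Ordinal jJ'))//= indicE mem_set// mulr1 -/(c j) lerDl.
  by apply: sumr_ge0 => i _; rewrite mulr_ge0.
rewrite ge0_integral_sum//.
apply: (@le_trans _ _ (\sum_(j < n.*2.+2)
   (vol_scale * (2 * 8 ^+ d * (m ^+ q / m ^+ d)) * 2^-1 ^+ j)%:E)%E).
  apply: lee_sum => j _; rewrite integral_cst_indic//; last exact: measurable_cap.
  apply: (@le_trans _ _ ((c j)%:E * (vol_scale * (2 * (r j *+ 2) ^+ d))%:E)%E).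
    apply: lee_wpmul2l; first by rewrite lee_fin.
    exact: Vol_cap_le.
  rewrite -EFinM lee_fin.
  have -> : r j *+ 2 = 2 ^+ j * (8 / m).
    by rewrite /r exprS -mulr_natr; field.
  rewrite exprMn expr_div_n -exprM /c.
  have q2 : (2 : R) ^+ (j * d) / 2 ^+ (j * q) <= 2^-1 ^+ j.
    rewrite ler_pdivrMr ?exprn_gt0// exprVn mulrC ler_pdivlMr ?exprn_gt0//.
    by rewrite -exprD ler_eXn2l ?ltr1n// -mulnSr leq_mul2l dq orbT.
  rewrite [leLHS](_ : _ = vol_scale * (2 * 8 ^+ d * (m ^+ q / m ^+ d)) *
      (2 ^+ (j * d) / 2 ^+ (j * q))); last first.
    by field; rewrite !expf_neq0.
  apply: ler_wpM2l => //.
  by rewrite !mulr_ge0 ?vol_scale_ge0 ?invr_ge0 ?exprn_ge0.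
rewrite sumEFin lee_fin -mulr_sumr.
rewrite [leRHS](_ : _ = vol_scale * (2 * 8 ^+ d * (m ^+ q / m ^+ d)) * 2); last by ring.
apply: ler_wpM2l; last exact: sum_half_le.
by rewrite !mulr_ge0 ?vol_scale_ge0 ?invr_ge0 ?exprn_ge0.
Qed.

(** Only the cap of chordal radius 1 / m is kept: there 1 - x_0 <= 1 / (2 m^2), so [dirichlet_ge]
    gives D >= m (1 - 1/24). *)
Lemma integral_dirichlet_ge h : ~~ odd h -> (1 <= d)%N ->
  ((vol_scale * (1 / 4 * (1 / m / d%:R) ^+ d * (23 / 24 * m) ^+ h))%:E <=
   \int[@Vol R d]_x (D.[x0 x] ^+ h)%:E)%E.
Proof.
move=> he d1; have m0 : 0 < m by [].
have m1 : 1 <= m by rewrite ler1n.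
pose c := (23 / 24 * m) ^+ h.
have c0 : 0 <= c by rewrite exprn_ge0// mulr_ge0.
have mcap := @measurable_cap R d (1 / m).
apply: (@le_trans _ _ (\int[@Vol R d]_x (c * \1_(@cap R d (1 / m)) x)%:E)%E).
  rewrite integral_cst_indic// mulrA [X in X%:E]mulrC EFinM.
  apply: lee_wpmul2l; first by rewrite lee_fin.
  by apply: Vol_cap_ge; rewrite ?divr_gt0// ler_pdivrMr// mul1r.
apply: ge0_le_integral => //.
- by move=> x _; rewrite lee_fin mulr_ge0.
- apply/measurable_EFinP; apply: measurable_funM; first exact: measurable_cst.
  exact: measurable_indic.
- exact: measurable_dirichlet0.
move=> x _; rewrite lee_fin indicE.
have [|_] := boolP (x \in _); last by rewrite mulr0 exprn_even_ge0.
rewrite inE mulr1 /cap/= expr_div_n expr1n => xc.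
apply: exprn_le; first by rewrite mulr_ge0.
apply: le_trans (dirichlet_ge n (coord0_bounds x)).
rewrite mulrC; apply: ler_wpM2l; first exact: ltW.
have : (1 - x0 x) * m ^+ 2 <= 1 / 2; last by lra.
rewrite -ler_pdivlMr ?exprn_gt0//.
have -> : 1 / 2 / m ^+ 2 = 1 / m ^+ 2 / 2 by rewrite mulrAC.
by rewrite ler_pdivlMr// mulrC.
Qed.

End KernelIntegrals.

(** * Couplings of a discrete measure *)

Section Density.
Context dd (T : measurableType dd) (R : realType).
Variables (mu : {measure set T -> \bar R}) (w : T -> R).
Hypotheses (mw : measurable_fun setT w) (w0 : forall x, 0 <= w x).
Local Open Scope ereal_scope.

Definition density (A : set T) : \bar R := \int[mu]_(x in A) (w x)%:E.

Let mEw : measurable_fun setT (EFin \o w).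
Proof. exact/measurable_EFinP. Qed.

Let density0 : density set0 = 0.
Proof. exact: integral_set0. Qed.

Let density_ge0 A : 0 <= density A.
Proof. by apply: integral_ge0 => x _; rewrite lee_fin. Qed.

Let density_sigma_additive : semi_sigma_additive density.
Proof.
by apply: (@semi_sigma_additive_nng_induced _ _ _ mu (EFin \o w)) => // x; rewrite lee_fin.
Qed.

HB.instance Definition _ := isMeasure.Build _ _ _ density
  density0 density_ge0 density_sigma_additive.

Definition density_measure : {measure set T -> \bar R} := density.

Lemma density_measureE A : density_measure A = \int[mu]_(x in A) (w x)%:E.
Proof. by []. Qed.

Import HBNNSimple.

Let integral_density_nnsfun (h : {nnsfun T >-> R}) :
  \int[density_measure]_x (h x)%:E = \int[mu]_x ((w x)%:E * (h x)%:E).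
Proof.
under [LHS]eq_integral do rewrite fimfunE -fsumEFin//.
rewrite [LHS]ge0_integral_fsum//; last 2 first.
  - by move=> r; exact/measurable_EFinP/measurableT_comp.
  - by move=> n x _; rewrite EFinM nnfun_muleindic_ge0.
under [RHS]eq_integral.
  move=> x xD; rewrite fimfunE -fsumEFin// ge0_mule_fsumr; last first.
    by move=> r; rewrite EFinM nnfun_muleindic_ge0.
  over.
rewrite [RHS]ge0_integral_fsum//; last 2 first.
  - move=> r; apply: emeasurable_funM => //.
    by apply/measurable_EFinP; do 2 apply/measurableT_comp => //.
  - move=> n x _; apply: mule_ge0; first by rewrite lee_fin.
    by rewrite EFinM nnfun_muleindic_ge0.
apply: eq_fsbigr => r; rewrite inE => -[x _ <-]; set s := h x.
have s0 : (0 <= s)%R by exact: fun_ge0.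
have mB : measurable (h @^-1` [set s]) by [].
rewrite integral_cst_indic// density_measureE.
under [RHS]eq_integral do rewrite EFinM muleCA.
rewrite ge0_integralZl_EFin//.
- rewrite integral_mkcond; congr (_ * _); apply: eq_integral => y _.
  by rewrite patchE indicE; case: ifPn => yB; rewrite ?mule1 ?mule0.
- by move=> y _; rewrite mule_ge0// lee_fin.
- apply: emeasurable_funM => //.
  by apply/measurable_EFinP; exact: measurable_indic.
Qed.

(** Monotone convergence along the simple approximations of [g], on both sides. *)
Lemma ge0_integral_density (g : T -> \bar R) :
  measurable_fun setT g -> (forall x, 0 <= g x) ->
  \int[density_measure]_x g x = \int[mu]_x ((w x)%:E * g x).
Proof.
move=> mg g0; pose g_ := nnsfun_approx measurableT mg.
have gE x : limn (fun n => (g_ n x)%:E) = g x.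
  by apply/cvg_lim => //; exact: cvg_nnsfun_approx.
have nd x : nondecreasing_seq (fun n => (g_ n x)%:E).
  by move=> a b ab; rewrite lee_fin; exact/lefP/nd_nnsfun_approx.
transitivity (limn (fun n => \int[density_measure]_x (g_ n x)%:E)).
  rewrite -monotone_convergence//.
  - by apply: eq_integral => x _; rewrite gE.
  - by move=> n; exact/measurable_EFinP.
  - by move=> n x _; rewrite lee_fin.
rewrite (_ : (fun n => _) = (fun n => \int[mu]_x ((w x)%:E * (g_ n x)%:E))); last first.
  by apply/funext => n; exact: integral_density_nnsfun.
rewrite -monotone_convergence//.
- apply: eq_integral => x _.
  have cv : cvgn (fun n => (g_ n x)%:E) by exact: ereal_nondecreasing_is_cvgn.
  by rewrite -(gE x) -(limeMl _ cv).
- by move=> n; apply: emeasurable_funM => //; exact/measurable_EFinP.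
- by move=> n x _; rewrite mule_ge0 ?lee_fin.
- by move=> x _ a b ab; apply: lee_wpmul2l; [rewrite lee_fin|exact: nd].
Qed.

End Density.

Section SemidiscreteCoupling.
Context d1 d2 (X : measurableType d1) (Y : measurableType d2) (R : realType).
Local Open Scope ereal_scope.

Let mpair (x : X) : measurable_fun setT (@pair X Y x).
Proof. exact: pair1_measurable. Qed.

(** The product of the Dirac measure at [x] with [mu]. *)
Definition fiber_measure (mu : {measure set Y -> \bar R}) (x : X) :
    {measure set (X * Y) -> \bar R} :=
  ltac:(move: (mpair x) => mp;
    exact: (HB.pack (pushforward mu (pair x)) (Measure.on (pushforward mu (pair x))))).

Lemma ge0_integral_fiber_measure mu x (g : X * Y -> \bar R) :
  measurable_fun setT g -> (forall z, 0 <= g z) ->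
  \int[fiber_measure mu x]_z g z = \int[mu]_y g (x, y).
Proof.
move=> mg g0; have mp : measurable_fun setT (@pair X Y x) by exact: pair1_measurable.
have g0' : {in [set: X * Y], forall z, 0 <= g z} by move=> z _; exact: g0.
have := ge0_integral_pushforward mp mu measurableT mg g0'.
by rewrite preimage_setT.
Qed.

Variables (mu : probability Y R) (N : nat) (a : 'I_N -> X) (v : 'I_N -> Y -> R).
Hypotheses (mv : forall i, measurable_fun setT (v i)) (v0 : forall i y, (0 <= v i y)%R).
Hypothesis v1 : forall y, (\sum_(i < N) v i y = 1)%R.

(** [v i y] is the share of the mass at [y] that is matched with the atom [a i]. The index is a
    natural number, with the zero measure beyond [N], because [msum] sums a sequence. *)
Definition coupling_atom (k : nat) : {measure set (X * Y) -> \bar R} :=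
  if insub k is Some i then fiber_measure (density_measure mu (mv i) (v0 i)) (a i)
  else mzero.

Definition semidiscrete : set (X * Y) -> \bar R := msum coupling_atom N.

HB.instance Definition _ := Measure.on semidiscrete.

Lemma semidiscreteE A : semidiscrete A =
  \sum_(i < N) \int[mu]_(y in pair (a i) @^-1` A) (v i y)%:E.
Proof.
by apply: eq_bigr => i _; rewrite /coupling_atom valK.
Qed.

(** The shares [v i y] add up to 1 at each [y]. *)
Lemma semidiscrete_setX2 B : measurable B -> semidiscrete (setT `*` B) = mu B.
Proof.
move=> mB; rewrite semidiscreteE.
under eq_bigr => i _.
  rewrite (_ : _ @^-1` _ = B); first over.
  by apply/seteqP; split => // y [].
rewrite -ge0_integral_sum//.
- under eq_integral => y _ do rewrite sumEFin v1.
  by rewrite integral_cst// mul1e.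
- by move=> i; apply/measurable_EFinP; exact: measurable_funTS.
- by move=> i y _; rewrite lee_fin.
Qed.

Let semidiscrete_setT : semidiscrete setT = 1.
Proof. by rewrite -setXTT semidiscrete_setX2// probability_setT. Qed.

HB.instance Definition _ := Measure_isProbability.Build _ _ _ semidiscrete
  semidiscrete_setT.

Definition semidiscrete_probability : probability (X * Y)%type R := semidiscrete.

Lemma semidiscrete_setX1 A : measurable A ->
  semidiscrete (A `*` setT) = \sum_(i < N) \d_(a i) A * \int[mu]_y (v i y)%:E.
Proof.
move=> mA; rewrite semidiscreteE; apply: eq_bigr => i _; rewrite diracE.
have [aA|aA] := boolP (a i \in A).
  rewrite mul1e (_ : _ @^-1` _ = setT)//.
  by apply/seteqP; split => // y _; split => //=; exact: set_mem.
rewrite mul0e (_ : _ @^-1` _ = set0) ?integral_set0//.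
by apply/seteqP; split => // y [/= h]; move: aA; rewrite mem_set.
Qed.

Lemma ge0_integral_semidiscrete (g : X * Y -> \bar R) :
  measurable_fun setT g -> (forall z, 0 <= g z) ->
  \int[semidiscrete_probability]_z g z =
  \sum_(i < N) \int[mu]_y ((v i y)%:E * g (a i, y)).
Proof.
move=> mg g0.
rewrite [LHS](ge0_integral_measure_sum coupling_atom measurableT)//.
apply: eq_bigr => i _; rewrite /coupling_atom valK.
rewrite ge0_integral_fiber_measure// ge0_integral_density//.
by apply: (measurableT_comp mg); exact: pair1_measurable.
Qed.

End SemidiscreteCoupling.

(** * The geodesic distance *)

Section GeodesicDistance.
Variables (R : realType) (d : nat).
Local Notation S := (sphere R d).

(** Cauchy-Schwarz for unit vectors, from |x + y|^2 >= 0 and |x - y|^2 >= 0. *)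
Lemma inner_sphere_bounds (x y : S) : -1 <= inner (scoord x) (scoord y) <= 1.
Proof.
have sq (z : S) : \sum_(i < d.+1) tnth (scoord z) i ^+ 2 = 1.
  by rewrite big_ord_recl sum_sqr_scoord.
have sqD e : \sum_(i < d.+1) (tnth (scoord x) i + e * tnth (scoord y) i) ^+ 2 =
    1 + e ^+ 2 + 2 * e * inner (scoord x) (scoord y).
  have -> : 1 + e ^+ 2 = \sum_(i < d.+1) tnth (scoord x) i ^+ 2 +
      e ^+ 2 * \sum_(i < d.+1) tnth (scoord y) i ^+ 2 by rewrite !sq mulr1.
  rewrite !mulr_sumr -!big_split/=.
  by apply: eq_bigr => i _; ring.
have sq0 e : 0 <= \sum_(i < d.+1) (tnth (scoord x) i + e * tnth (scoord y) i) ^+ 2.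
  by apply: sumr_ge0 => i _; rewrite sqr_ge0.
by apply/andP; split; [have := sq0 1|have := sq0 (-1)]; rewrite sqD; lra.
Qed.

Lemma geodist_bounds (x y : S) : 0 <= geodist x y <= pi.
Proof.
by rewrite acos_ge0 ?inner_sphere_bounds// acos_lepi// inner_sphere_bounds.
Qed.

Lemma cos_geodist (x y : S) : cos (geodist x y) = inner (scoord x) (scoord y).
Proof. by rewrite acosK// in_itv/= inner_sphere_bounds. Qed.

Lemma measurable_inner2 :
  measurable_fun setT (fun z : S * S => inner (scoord z.1) (scoord z.2)).
Proof.
apply: measurable_sum => i; apply: measurable_funM.
- apply: (measurableT_comp (f := fun z : d.+1.-tuple R => tnth z i)).
    exact: measurable_tnth.
  by apply: measurableT_comp; [exact: measurable_scoord|exact: measurable_fst].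
- apply: (measurableT_comp (f := fun z : d.+1.-tuple R => tnth z i)).
    exact: measurable_tnth.
  by apply: measurableT_comp; [exact: measurable_scoord|exact: measurable_snd].
Qed.

(** It suffices to treat open rays above [c]; for c in [0, pi], as cosine decreases there, the
    distance exceeds [c] exactly when the inner product is below cos c. *)
Lemma measurable_geodist :
  measurable_fun setT (fun z : S * S => geodist z.1 z.2).
Proof.
apply: (measurability _ (RGenOInfty.measurableE R)) => _ [_ [c ->] <-].
rewrite setTI; have [c0|c0] := ltP c 0.
  rewrite (_ : _ @^-1` _ = setT)//; apply/seteqP; split => // z _ /=.
  by rewrite in_itv/= andbT (lt_le_trans c0)//; case/andP: (geodist_bounds z.1 z.2).
have [cpi|cpi] := ltP pi c.
  rewrite (_ : _ @^-1` _ = set0)//; apply/seteqP; split => // z /=.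
  rewrite in_itv/= andbT => cz; case/andP: (geodist_bounds z.1 z.2) => _.
  by rewrite leNgt (lt_trans cpi).
rewrite (_ : _ @^-1` _ =
    (fun z : S * S => inner (scoord z.1) (scoord z.2)) @^-1` `]-oo, cos c[%classic).
  by rewrite -[X in measurable X]setTI; exact: measurable_inner2.
apply/seteqP; split => z /=; rewrite !in_itv/= andbT -cos_geodist ltr_cos//;
  by rewrite in_itv/= ?geodist_bounds// c0.
Qed.

End GeodesicDistance.

(** * Comparison of cost exponents *)

Section Young.
Variable R : realType.

(** Young's inequality for (r / c)^p and 1, with exponents L / p and L / (L - p). It is the
    pointwise form of W_p <= W_L, with an even [L] to be taken later. *)
Lemma powR_le_mix (r c p : R) (L : nat) : 0 <= r -> 0 < c -> 0 < p -> p < L%:R ->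
  r `^ p <= c `^ p * (p / L%:R * (r / c) ^+ L + (1 - p / L%:R)).
Proof.
move=> r0 c0 p0 pL; have L0 : 0 < L%:R :> R by exact: lt_trans pL.
have rc0 : 0 <= r / c by rewrite divr_ge0// ltW.
rewrite -{1}(divfK (lt0r_neq0 c0) r) powRM// ?(ltW c0)// mulrC.
apply: ler_wpM2l; first exact: powR_ge0.
have := @conjugate_powR R ((r / c) `^ p) 1 (L%:R / p) (L%:R / (L%:R - p)).
rewrite powR_ge0 => /(_ isT ler01).
rewrite !divr_gt0// ?subr_gt0// => /(_ isT isT).
rewrite mulr1 powR1 -powRrM mulrCA mulfV ?gt_eqF// mulr1 powR_mulrn//.
have -> : (L%:R / p)^-1 + (L%:R / (L%:R - p))^-1 = 1.
  by field; rewrite ?gt_eqF// subr_gt0.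
move=> /(_ erefl) h; apply: (le_trans h).
rewrite le_eqVlt; apply/orP; left; apply/eqP.
by field; rewrite ?gt_eqF// subr_gt0.
Qed.

End Young.

(** * The transport bound and the choice of exponents *)

Section DesignBound.
Variables (R : realType) (d : nat).
Local Notation S := (sphere R d).
Local Notation x0 x := (tnth (scoord x) ord0).

Lemma innerC n (x y : n.-tuple R) : inner x y = inner y x.
Proof. by apply: eq_bigr => i _; rewrite mulrC. Qed.

Lemma integral_zonal_poly (P : {poly R}) (y : S) : (1 <= d)%N ->
  (forall u, 0 <= P.[u]) ->
  (\int[@Vol R d]_x (P.[inner (scoord x) (scoord y)])%:E =
   \int[@Vol R d]_x (P.[x0 x])%:E)%E.
Proof.
move=> d1 P0; pose F (u : R) := (P.[u])%:E.
have mF : measurable_fun setT F by apply/measurable_EFinP; exact: measurable_horner.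
have F0 u : (0 <= F u)%E by rewrite lee_fin.
have := ge0_integral_zonal y d1 mF F0; rewrite /F => ->.
by under eq_integral do rewrite inner_north.
Qed.

Lemma measurable_zonal_poly (P : {poly R}) (y : S) :
  measurable_fun setT (fun x : S => P.[inner (scoord x) (scoord y)]).
Proof.
by apply: (measurableT_comp (measurable_horner P)); exact: measurable_inner.
Qed.

(* The polynomial kernel [K] spreads each atom [a n] into the density
   [K (<a n, y>) / kappa]; the design property says that these average to 1, so
   that the spreading is a coupling with [Vol]. *)
Lemma wasserstein_design_le (t N : nat) (a : 'I_N -> S) (K G : {poly R})
    (kappa c p : R) (L : nat) :
  (1 <= d)%N -> (0 < N)%N -> spherical_design t a -> (size K <= t.+1)%N ->
  (forall u, 0 <= K.[u]) -> (forall u, 0 <= G.[u]) ->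
  0 < kappa -> 0 < c -> 0 < p -> p < L%:R ->
  (\int[@Vol R d]_x (K.[x0 x])%:E = kappa%:E)%E ->
  (forall u, -1 <= u <= 1 -> acos u ^+ L * K.[u] <= G.[u]) ->
  (\int[@Vol R d]_x (G.[x0 x])%:E <= (c ^+ L * kappa)%:E)%E ->
  (wasserstein p (empirical a) (@Vol R d) <= c%:E)%E.
Proof.
move=> d1 N0 des sK K0 G0 k0 c0 p0 pL Kk KG Gk.
have NR0 : 0 < N%:R :> R by rewrite ltr0n.
have L0 : 0 < L%:R :> R by exact: lt_trans pL.
pose w : R := N%:R^-1 / kappa.
have w0 : 0 <= w by rewrite divr_ge0 ?invr_ge0// ltW.
pose v i (y : S) := w * K.[inner (scoord y) (scoord (a i))].
have mv i : measurable_fun setT (v i).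
  apply: measurable_funM; first exact: measurable_cst.
  exact: measurable_zonal_poly.
have v0 i y : 0 <= v i y by rewrite mulr_ge0.
have v1 y : \sum_(i < N) v i y = 1.
  (* The design property turns the average over the atoms into an integral centred at [y], and
     rotation invariance removes the dependence on [y]. *)
  have e : N%:R^-1 * \sum_(i < N) K.[inner (scoord y) (scoord (a i))] = kappa.
    apply: EFin_inj; rewrite -Kk -(integral_zonal_poly y d1 K0).
    under eq_bigr => i _ do rewrite innerC -(meval_zonal (scoord y) (scoord (a i))).
    rewrite (des _ (leq_trans (msize_zonal _ _) sK)).
    by apply: eq_integral => x _; rewrite meval_zonal.
  by rewrite /v -mulr_sumr /w mulrAC e divff// gt_eqF.
have int_scale (P : {poly R}) y (b : R) : (forall u, 0 <= P.[u]) -> 0 <= b ->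
    (\int[@Vol R d]_x (b * P.[inner (scoord x) (scoord y)])%:E =
     b%:E * \int[@Vol R d]_x (P.[x0 x])%:E)%E.
  move=> P0 b0; under eq_integral do rewrite EFinM.
  rewrite ge0_integralZl_EFin//.
  - by rewrite integral_zonal_poly.
  - by move=> x _; rewrite lee_fin.
  - by apply/measurable_EFinP; exact: measurable_zonal_poly.
have int_v i : (\int[@Vol R d]_y (v i y)%:E = (N%:R^-1)%:E)%E.
  by rewrite int_scale// Kk -EFinM /w mulfVK// gt_eqF.
pose theta := semidiscrete_probability (@Vol R d) a mv v0 v1.
have theta_coupling : coupling (empirical a) (@Vol R d) theta.
  move=> A mA; split; last exact: semidiscrete_setX2.
  apply: (etrans (semidiscrete_setX1 (@Vol R d) a mv v0 mA)).
  rewrite /empirical ge0_sume_distrr//; apply: eq_bigr => i _.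
  by rewrite int_v muleC.
(* The coefficients that [powR_le_mix] puts on r^L and on 1: [H] dominates rho^p K, and its integral
   is at most al c^L kappa + be kappa = c^p kappa. *)
pose al := c `^ p * (p / L%:R) / c ^+ L.
pose be := c `^ p * (1 - p / L%:R).
have cp0 : 0 <= c `^ p by exact: powR_ge0.
have pL0 : 0 <= p / L%:R by rewrite divr_ge0// ltW.
have cL0 : 0 < c ^+ L by rewrite exprn_gt0.
have al0 : 0 <= al by apply: divr_ge0; [exact: mulr_ge0|exact: ltW].
have be0 : 0 <= be by rewrite mulr_ge0// subr_ge0 ler_pdivrMr// mul1r ltW.
pose H : {poly R} := al *: G + be *: K.
have HE u : H.[u] = al * G.[u] + be * K.[u] by rewrite !hornerE.
have H0 u : 0 <= H.[u] by rewrite HE addr_ge0// mulr_ge0.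
have mcoord (P : {poly R}) : measurable_fun setT (fun x : S => (P.[x0 x])%:E).
  apply/measurable_EFinP; apply: (measurableT_comp (measurable_horner P)).
  exact: measurable_coord0.
have intH : (\int[@Vol R d]_x (H.[x0 x])%:E <= (c `^ p * kappa)%:E)%E.
  under eq_integral do rewrite HE EFinD !EFinM.
  rewrite ge0_integralD//; last 4 first.
  - by move=> x _; rewrite mule_ge0 ?lee_fin.
  - by apply: measurable_funeM; exact: mcoord.
  - by move=> x _; rewrite mule_ge0 ?lee_fin.
  - by apply: measurable_funeM; exact: mcoord.
  rewrite !ge0_integralZl_EFin//; last 2 first.
  - by move=> x _; rewrite lee_fin.
  - by move=> x _; rewrite lee_fin.
  rewrite Kk; apply: (@le_trans _ _ (al%:E * (c ^+ L * kappa)%:E + be%:E * kappa%:E)%E).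
    by rewrite leeD2r// lee_wpmul2l// lee_fin.
  rewrite -!EFinM -EFinD lee_fin /al /be le_eqVlt; apply/orP; left; apply/eqP.
  by field; rewrite ?expf_neq0 ?gt_eqF.
have cost : (\int[theta]_z ((geodist z.1 z.2) `^ p)%:E <= (c `^ p)%:E)%E.
  rewrite ge0_integral_semidiscrete; last 2 first.
  - apply/measurable_EFinP; apply: (measurableT_comp (@measurable_powR R p)).
    exact: measurable_geodist.
  - by move=> z; rewrite lee_fin powR_ge0.
  apply: (@le_trans _ _ (\sum_(i < N) (w%:E * (c `^ p * kappa)%:E))%E).
    apply: lee_sum => i _.
    apply: (@le_trans _ _
      (\int[@Vol R d]_y (w * H.[inner (scoord y) (scoord (a i))])%:E)%E).
      apply: ge0_le_integral => //.
      - by move=> y _; rewrite mule_ge0// lee_fin ?powR_ge0.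
      - apply: emeasurable_funM; first by apply/measurable_EFinP.
        apply/measurable_EFinP; apply: (measurableT_comp (@measurable_powR R p)).
        apply: (measurableT_comp (@measurable_geodist R d)).
        exact: pair1_measurable.
      - apply/measurable_EFinP; apply: measurable_funM; first exact: measurable_cst.
        exact: measurable_zonal_poly.
      move=> y _; rewrite -EFinM lee_fin -mulrA ler_wpM2l// HE.
      set u := inner _ _; set r := geodist _ _.
      have rE : r = acos u by rewrite /r /geodist innerC.
      have r0 : 0 <= r by have /andP[] := geodist_bounds (a i) y.
      apply: (@le_trans _ _ (K.[u] * (c `^ p * (p / L%:R * (r / c) ^+ L + (1 - p / L%:R))))).
        by apply: ler_wpM2l => //; exact: powR_le_mix.
      have -> : K.[u] * (c `^ p * (p / L%:R * (r / c) ^+ L + (1 - p / L%:R))) =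
          al * (r ^+ L * K.[u]) + be * K.[u].
        rewrite /al /be expr_div_n; field.
        by rewrite expf_neq0 ?gt_eqF.
      rewrite lerD2r ler_wpM2l// rE; apply: KG.
      exact: inner_sphere_bounds.
    by rewrite int_scale// lee_wpmul2l// lee_fin.
  rewrite -EFinM sumEFin sumr_const card_ord lee_fin -mulr_natl /w.
  rewrite le_eqVlt; apply/orP; left; apply/eqP; field.
  by rewrite !gt_eqF.
apply: le_trans.
  apply: ereal_inf_lbound; exists theta; first exact: theta_coupling.
  reflexivity.
have cE : (c%:E = (c `^ p)%:E `^ p^-1)%E.
  by rewrite poweR_EFin -powRrM mulfV ?gt_eqF// powRr1// ltW.
rewrite [leRHS]cE; apply: gt0_ler_poweR => //.
- by rewrite invr_ge0 ltW.
- rewrite in_itv/= leey andbT; apply: integral_ge0 => z _.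
  by rewrite lee_fin powR_ge0.
- by rewrite in_itv/= leey andbT lee_fin.
Qed.

End DesignBound.

(** * Numerical estimates for the constant *)

Section Numerics.
Variable R : realType.

(** From exp (-1/10) >= 9/10; the tenth power then gives e <= (10/9)^10 < 2.87. *)
Lemma expR_tenth : expR (1 / 10 : R) <= 10 / 9.
Proof.
have h : 9 / 10 <= expR (- (1 / 10) : R).
  by apply: le_trans (expR_ge1Dx _); lra.
rewrite -[1 / 10]opprK expRN invf_ple ?posrE ?expR_gt0//.
by apply: le_trans h; rewrite invf_div.
Qed.

Lemma expR1_le : expR (1 : R) <= 287 / 100.
Proof.
rewrite (_ : 1 = 10%:R * (1 / 10)); last by field.
rewrite expRM_natl (le_trans (exprn_le 10 (expR_ge0 _) expR_tenth))//.
by rewrite expr_div_n; lra.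
Qed.

(** e^5 <= 2.87^5 < 200 <= 100 d. *)
Lemma ln_100d_ge5 (d : nat) : (2 <= d)%N -> 5 <= ln (100 * d%:R : R).
Proof.
move=> d2; have d2R : 2 <= d%:R :> R by rewrite ler_nat.
rewrite -ler_expR lnK ?posrE; last by lra.
rewrite (_ : 5 = 5%:R * 1 :> R); last by rewrite mulr1.
rewrite expRM_natl (le_trans (exprn_le 5 (expR_ge0 _) expR1_le))//.
by apply: (@le_trans _ _ 200); [rewrite expr_div_n|]; lra.
Qed.

(* [16 (8 d)^d <= (100 d)^d <= e^P]: this is where [ln (100 d)] is needed. *)
Lemma dimension_factor_le (d L : nat) (P : R) : (2 <= d)%N ->
  d%:R * ln (100 * d%:R) <= P -> P <= L%:R ->
  16 * (8 * d%:R) ^+ d <= (287 / 100) ^+ L :> R.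
Proof.
move=> d2 dP PL; have d2R : 2 <= d%:R :> R by rewrite ler_nat.
apply: (@le_trans _ _ ((100 * d%:R) ^+ d)).
  rewrite (_ : 100 * d%:R = 25 / 2 * (8 * d%:R)); last by field.
  rewrite [leRHS]exprMn; apply: ler_wpM2r; first by rewrite exprn_ge0; lra.
  (* The spare factor (25/2)^d absorbs 16, as d >= 2. *)
  apply: (@le_trans _ _ ((25 / 2) ^+ 2)); first by lra.
  by apply: ler_weXn2l => //; lra.
rewrite -[X in X ^+ d]lnK ?posrE; last by lra.
rewrite -expRM_natl; apply: (@le_trans _ _ (expR L%:R)).
  by rewrite ler_expR (le_trans dP).
rewrite -[X in expR X]mulr1 expRM_natl; apply: exprn_le; first exact: expR_ge0.
exact: expR1_le.
Qed.

(* With [m >= t / h] and [h <= 8 P / 5] one has [c m >= 35 / 2]. *)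
Lemma kernel_ratio_le (d q L h t : nat) (m P : R) :
  (2 <= d)%N -> (0 < t)%N -> 0 < m -> t%:R <= h%:R * m ->
  d%:R * ln (100 * d%:R) <= P -> P <= L%:R -> h%:R <= 8 / 5 * P ->
  (h <= 2 * L)%N -> h = (L + q)%N ->
  5 ^+ L * (4 * 8 ^+ d * (m ^+ q / m ^+ d)) <=
  (14 * d%:R * P / t%:R) ^+ L *
  (1 / 4 * (1 / m / d%:R) ^+ d * (23 / 24 * m) ^+ h).
Proof.
move=> d2 t0 m0 tm dP PL hP hL hE.
have d2R : 2 <= d%:R :> R by rewrite ler_nat.
have t0R : 0 < t%:R :> R by rewrite ltr0n.
have P0 : 0 < P.
  by have := ln_100d_ge5 d2; move: dP; set l := ln _; nra.
set c := 14 * d%:R * P / t%:R.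
have c0 : 0 < c by rewrite divr_gt0// !mulr_gt0//; lra.
have cm : 35 / 2 <= c * m.
  rewrite /c mulrAC ler_pdivlMr//; apply: (@le_trans _ _ (35 / 2 * (8 / 5 * P * m))).
    by apply: ler_wpM2l => //; apply: (le_trans tm); rewrite ler_wpM2r// ltW.
  by have := mulr_gt0 P0 m0; nra.
(* What remains once the common factor m^q / (4 (m d)^d) is taken out of both sides. *)
have key : 16 * (8 * d%:R) ^+ d * 5 ^+ L <= (c * m) ^+ L * (23 / 24) ^+ h :> R.
  apply: (@le_trans _ _ ((287 / 100) ^+ L * 5 ^+ L)).
    by apply: ler_wpM2r; [rewrite exprn_ge0|exact: dimension_factor_le dP PL].
  apply: (@le_trans _ _ ((35 / 2) ^+ L * (23 / 24) ^+ (2 * L))).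
    (* Comparison of the bases: 5 * 2.87 = 14.35, whereas 35/2 * (23/24)^2 exceeds 16. *)
    by rewrite exprM -!exprMn; apply: exprn_le; lra.
  apply: ler_pM; rewrite ?exprn_ge0//.
    by apply: exprn_le.
  by apply: ler_wiXn2l => //; lra.
have m1 : m != 0 by rewrite gt_eqF.
have dn0 : d%:R != 0 :> R by rewrite gt_eqF//; lra.
have -> : 5 ^+ L * (4 * 8 ^+ d * (m ^+ q / m ^+ d)) =
    16 * (8 * d%:R) ^+ d * 5 ^+ L * (m ^+ q / (4 * (m * d%:R) ^+ d)) :> R.
  by rewrite !exprMn; field; rewrite !expf_neq0.
have -> : c ^+ L * (1 / 4 * (1 / m / d%:R) ^+ d * (23 / 24 * m) ^+ h) =
    (c * m) ^+ L * (23 / 24) ^+ h * (m ^+ q / (4 * (m * d%:R) ^+ d)).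
  have mh : m ^+ h = m ^+ L * m ^+ q by rewrite hE exprD.
  have -> : 1 / m / d%:R = (m * d%:R)^-1 by field; rewrite m1 dn0.
  rewrite exprVn (exprMn h) mh (exprMn L c).
  have : (m * d%:R) ^+ d != 0 by rewrite expf_neq0// mulf_neq0.
  by set X := _ ^+ d; set e := (23 / 24) ^+ h => X0; field.
apply: ler_wpM2r => //; rewrite divr_ge0 ?exprn_ge0 ?mulr_ge0 ?exprn_ge0 ?mulr_ge0//; exact: ltW.
Qed.

End Numerics.

(** [L] and [q] are the least even integers above P and d, so L + q <= P + d + 4. As P >= 5 d >= 10,
    one has d <= P / 5 and 4 <= 2 P / 5, whence the factor 8/5. *)
Lemma exponent_choice (R : realType) (d : nat) (P : R) : (2 <= d)%N ->
  d%:R * ln (100 * d%:R) <= P ->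
  exists L q : nat, [/\ ~~ odd L, ~~ odd q, P < L%:R, (d < q)%N &
    (L + q <= 2 * L)%N /\ (L + q)%:R <= 8 / 5 * P].
Proof.
move=> d2 dP; have d2R : 2 <= d%:R :> R by rewrite ler_nat.
have P5 : 5 * d%:R <= P.
  by apply: le_trans dP; rewrite mulrC; apply: ler_wpM2l; [lra|exact: ln_100d_ge5].
pose k := Num.truncn (P / 2).
have kP : k%:R <= P / 2 by have /truncn_itv/andP[] : 0 <= P / 2 by lra.
have kP' : P / 2 < k%:R + 1 by rewrite natr1 truncnS_gt.
exists k.+1.*2, d./2.+1.*2; rewrite !odd_double.
have LE : k.+1.*2%:R = 2 * (k%:R + 1) :> R by rewrite -mul2n natrM natr1.
have qd : (d./2.+1.*2 <= d + 2)%N by rewrite doubleS addn2 !ltnS halfK leq_subr.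
have qdR : d./2.+1.*2%:R <= d%:R + 2 :> R by rewrite -(natrD _ d 2) ler_nat.
split => //.
- by rewrite LE; lra.
- by rewrite -[X in (X < _)%N]odd_double_half doubleS; case: (odd d); rewrite ?ltnS.
split.
  rewrite mul2n -[leqRHS]addnn leq_add2l -(ler_nat R) LE (le_trans qdR)//; lra.
by rewrite natrD LE; lra.
Qed.

Theorem corollary9 (R : realType) (d t N : nat) (p : R)
    (a : 'I_N -> sphere R d) :
  (2 <= d)%N -> (1 <= t)%N -> (0 < N)%N ->
  spherical_design t a ->
  1 <= p ->
  let C := 14 * d%:R * Num.max (d%:R * ln (100 * d%:R)) p in
  (wasserstein p (empirical a) (@Vol R d) <= (C / t%:R)%:E)%E.
Proof.
move=> d2 t1 N0 des p1 /=; set P := Num.max _ p; set C := 14 * d%:R * P.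
have dP : d%:R * ln (100 * d%:R) <= P by rewrite le_max lexx.
have pP : p <= P by rewrite le_max lexx orbT.
have [L [q [Le qe PL dq [hL hP]]]] := exponent_choice d2 dP.
(* The largest [n] with n h <= t, so that D^h has degree at most t. *)
pose h := (L + q)%N; pose n := (t %/ h)%N; pose m : R := n.*2.+1%:R.
have h0 : (0 < h)%N by rewrite addn_gt0 (leq_ltn_trans _ dq) ?orbT.
have he : ~~ odd h by rewrite oddD (negbTE Le).
have dh : (d < h)%N by rewrite (leq_trans dq)// leq_addl.
have d1 : (1 <= d)%N by exact: ltnW.
(* t < (n + 1) h and n + 1 <= 2n + 1. *)
have tm : t%:R <= h%:R * m.
  rewrite -natrM ler_nat ltnW// (leq_trans (ltn_ceil t h0))// mulnC leq_mul2l.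
  by rewrite ltnS -addnn leq_addr orbT.
pose D := dirichlet R n.
pose c := C / t%:R.
have d2R : 2 <= d%:R :> R by rewrite ler_nat.
have c0 : 0 < c by rewrite divr_gt0 ?ltr0n// /C !mulr_gt0//; lra.
have ratio := kernel_ratio_le d2 t1 (ltr0Sn R n.*2) tm dP (ltW PL) hP hL erefl.
pose I k := (\int[@Vol R d]_x ((dirichlet R n).[tnth (scoord x) ord0] ^+ k)%:E)%E.
(* For the exponent [h] the upper bound only shows that the integral is finite; the lower bound
   makes [kappa] positive and enters the final estimate. *)
have Ih_le : (I h <= _)%E := @integral_dirichlet_le R d n h he dh.
have Ih_ge : (_ <= I h)%E := @integral_dirichlet_ge R d n h he d1.
have Ih0 : (0 <= I h)%E by apply: integral_ge0 => x _; rewrite lee_fin exprn_even_ge0.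
have Ih_fin : I h \is a fin_num.
  by rewrite ge0_fin_numE// (le_lt_trans Ih_le)// ltry.
pose kappa := fine (I h).
have kappaE : I h = kappa%:E by rewrite fineK.
move: Ih_ge; rewrite kappaE lee_fin => kappa_ge.
have kappa0 : 0 < kappa.
  apply: lt_le_trans kappa_ge; rewrite mulr_gt0 ?vol_scale_gt0//.
  by rewrite !mulr_gt0 ?exprn_gt0 ?divr_gt0 ?mulr_gt0// ltr0n.
(* The choice G = 5^L D^q dominates rho^L D^(L + q), because rho |D| <= 5 and [L] is even. *)
apply: (@wasserstein_design_le R d t N a (D ^+ h) (5 ^+ L *: D ^+ q) kappa c p L) => //.
- apply: (leq_trans (size_poly_exp_leq _ _)); rewrite ltnS.
  apply: (@leq_trans (n * h)%N); last exact: leq_divM.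
  by rewrite leq_mul2r -[_.-1]subn1 leq_subLR add1n size_dirichlet orbT.
- by move=> u; rewrite horner_exp exprn_even_ge0.
- by move=> u; rewrite hornerZ horner_exp mulr_ge0// exprn_even_ge0.
- exact: lt_le_trans p1.
- exact: le_lt_trans pP PL.
- by rewrite -kappaE; apply: eq_integral => x _; rewrite horner_exp.
- move=> u u1; rewrite hornerZ !horner_exp exprD mulrA; apply: ler_wpM2r.
    exact: exprn_even_ge0.
  rewrite -[X in _ * X]ger0_norm ?exprn_even_ge0// normrX -exprMn.
  by apply: exprn_le; [rewrite mulr_ge0// acos_ge0|exact: acos_dirichlet].
under eq_integral do rewrite hornerZ horner_exp EFinM.
rewrite ge0_integralZl_EFin//; last 2 first.
- by move=> x _; rewrite lee_fin exprn_even_ge0.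
- exact: measurable_dirichlet0.
apply: (le_trans (lee_wpmul2l _ (@integral_dirichlet_le R d n q qe dq))) => //.
rewrite -EFinM lee_fin mulrCA.
(* Both integral bounds carry the factor [vol_scale], so only the inequality [ratio] is left to
   use. *)
apply: (le_trans (ler_wpM2l (vol_scale_ge0 R d) ratio)).
rewrite mulrCA; apply: ler_wpM2l; first by rewrite exprn_ge0// ltW.
exact: kappa_ge.
Qed.
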